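(* Let $A\in\mathbb{R}^{d\times d}$, $B\in\mathbb{R}^{d\times m}$ and consider the linear control system $\dot x(t)=Ax(t)+B\omega(t)$, $\omega\in\mathcal{U}$, on $\mathbb{R}^d$. Assume that $(A,B)$ is controllable (i.e. $\operatorname{rank}[B\ AB\ \cdots\ A^{d-1}B]=d$), that $A$ is hyperbolic (no eigenvalues on the imaginary axis), and that the control range $U$ is a compact neighborhood of the origin in $\mathbb{R}^m$. Let $D$ be the unique control set with nonempty interior and let $f\in C(U,\mathbb{R})$. Then for every compact set $K\subset D$ the pair $(K,D)$ is admissible and $$P_{inv}(f,K,D)\le\sum_{\lambda\in\sigma(A)}\max\{0,n_\lambda\operatorname{Re}(\lambda)\}+\inf\frac1T\int_0^T f(\omega(s))\,ds,$$ where $n_\lambda$ is the algebraic multiplicity of the eigenvalue $\lambda$, and the infimum is taken over all $T>0$ and all $T$-periodic controls $\omega(\cdot)\in\mathcal{U}$ having a $T$-periodic trajectory $x(\cdot)$ contained in $\mathrm{int}\,D$ and such that $\{\omega(t);\,t\in[0,T]\}$ is contained in a compact subset of $\mathrm{int}\,U$.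
   Context: $\mathcal{U}$ is the set of measurable functions $\omega:\mathbb{R}\to U$, where $U\subset\mathbb{R}^m$ is compact (the control range). The trajectory is $\varphi(t,x,\omega)=e^{tA}x+\int_0^te^{(t-s)A}B\omega(s)\,ds$, $t\ge0$. $C(U,\mathbb{R})$ is the set of continuous functions $U\to\mathbb{R}$. The positive orbit of $x$ is $\mathcal{O}^+(x)=\{y:\ \exists\,t>0,\ \omega\in\mathcal{U}\text{ with }\varphi(t,x,\omega)=y\}$. A set $Q$ is controlled invariant if for all $x\in Q$ there is $\omega\in\mathcal{U}$ with $\varphi(t,x,\omega)\in Q$ for all $t\ge0$. A control set is a controlled invariant set $D$ with $D\subset\overline{\mathcal{O}^+(x)}$ for all $x\in D$ that is maximal (with respect to inclusion) among controlled invariant sets with this property. Known fact: under the stated controllability assumption and with $U$ a compact neighborhood of the origin, there is exactly one control set $D$ with nonempty interior. A pair $(K,Q)$ of nonempty sets is admissible if $K$ is compact and for each $x\in K$ there is $\omega\in\mathcal{U}$ with $\varphi(\mathbb{R}_+,x,\omega)\subset Q$ (where $\mathbb{R}_+=[0,\infty)$). For $\tau>0$, a set $\mathcal{S}\subset\mathcal{U}$ is $(\tau,K,Q)$-spanning if for all $x\in K$ there is $\omega\in\mathcal{S}$ with $\varphi(t,x,\omega)\in Q$ for all $t\in[0,\tau]$. With $(S_\tau f)(\omega)=\int_0^\tau f(\omega(t))\,dt$, put $$a_\tau(f,K,Q)=\inf\Big\{\sum_{\omega\in\mathcal{S}}e^{(S_\tau f)(\omega)};\ \mathcal{S}\ (\tau,K,Q)\text{-spanning}\Big\}\in[0,\infty],\qquad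 P_{inv}(f,K,Q)=\limsup_{\tau\to\infty}\frac1\tau\log a_\tau(f,K,Q).$$ $\sigma(A)$ denotes the set of (distinct, complex) eigenvalues of $A$. *)

(* Defs.v *)
From HB Require Import structures.
From mathcomp Require Import all_boot all_order all_algebra.
From mathcomp Require Import all_classical all_reals all_analysis.
From mathcomp.real_closed Require Import complex.
Set Implicit Arguments.
Unset Strict Implicit.
Unset Printing Implicit Defensive.
Import Order.TTheory GRing.Theory Num.Theory.
Import numFieldNormedType.Exports.
Local Open Scope classical_set_scope.
Local Open Scope ring_scope.

Definition expmx (R : realType) (d : nat) (A : 'M[R]_d) : 'M[R]_d :=
  lim (series (fun k => (k`!%:R)^-1 *: A ^+ k) @ \oo).

Definition complex_mx (R : realType) (d : nat) (A : 'M[R]_d) : 'M[R[i]]_d :=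
  map_mx (real_complex R) A.

Definition spectrum (R : realType) (d : nat) (A : 'M[R]_d) : set R[i] :=
  [set l | eigenvalue (complex_mx A) l].

Definition alg_mult (R : realType) (d : nat) (A : 'M[R]_d) (l : R[i]) : nat :=
  mup l (char_poly (complex_mx A)).

Definition hyperbolic (R : realType) (d : nat) (A : 'M[R]_d) : Prop :=
  forall l, spectrum A l -> complex.Re l != 0.

Definition controllable (R : realType) (d m : nat)
    (A : 'M[R]_d) (B : 'M[R]_(d, m)) : Prop :=
  \rank (\mxrow_(k < d) (A ^+ k *m B)) = d.

(* Measurability is understood entrywise, for the Borel sigma-algebra of R. *)
Definition controls (R : realType) (m : nat) (U : set 'cV[R]_m) :
    set (R -> 'cV[R]_m) :=
  [set w : R -> 'cV[R]_m | (forall i, measurable_fun [set: R] (fun t => w t i ord0)) /\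
           (forall t, U (w t))].

(* Only meant for t >= 0; the integral is taken entrywise. *)
Definition trajectory (R : realType) (d m : nat)
    (A : 'M[R]_d) (B : 'M[R]_(d, m))
    (t : R) (x : 'cV[R]_d) (w : R -> 'cV[R]_m) : 'cV[R]_d :=
  expmx (t *: A) *m x +
  \col_i \int[lebesgue_measure]_(s in `[0, t])
           (expmx ((t - s) *: A) *m B *m w s) i ord0.

Section control_system.
Variables (R : realType) (d m : nat).
Variables (A : 'M[R]_d) (B : 'M[R]_(d, m)) (U : set 'cV[R]_m).
Implicit Types (K Q D : set 'cV[R]_d) (x : 'cV[R]_d) (f : 'cV[R]_m -> R).
Implicit Types (w : R -> 'cV[R]_m) (S : set (R -> 'cV[R]_m)).

Local Notation phi := (trajectory A B).

Definition positive_orbit x : set 'cV[R]_d :=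
  [set y | exists t w, [/\ 0 < t, controls U w & phi t x w = y]].

Definition controlled_invariant Q : Prop :=
  forall x, Q x ->
    exists2 w, controls U w & forall t, 0 <= t -> Q (phi t x w).

Definition approx_controllable D : Prop :=
  forall x, D x -> D `<=` closure (positive_orbit x).

Definition control_set D : Prop :=
  [/\ controlled_invariant D, approx_controllable D &
      forall D', controlled_invariant D' -> approx_controllable D' ->
        D `<=` D' -> D' = D].

Definition admissible K Q : Prop :=
  [/\ K !=set0, Q !=set0, compact K &
      forall x, K x ->
        exists2 w, controls U w & forall t, 0 <= t -> Q (phi t x w)].

Definition spanning (tau : R) K Q S : Prop :=
  S `<=` controls U /\
  forall x, K x ->
    exists2 w, S w & forall t, 0 <= t <= tau -> Q (phi t x w).

Definition action (tau : R) f w : R :=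
  \int[lebesgue_measure]_(t in `[0, tau]) f (w t).

Definition a_inf (tau : R) f K Q : \bar R :=
  ereal_inf [set (\esum_(w in S) (expR (action tau f w))%:E)%E
            | S in spanning tau K Q].

Definition P_inv f K Q : \bar R :=
  limf_esup (fun tau : R => (tau^-1%:E * lne (a_inf tau f K Q))%E) +oo%R.

(* The periodic trajectory is given by its initial value; both it and its
   periodicity only concern times t >= 0. *)
Definition periodic_averages D f : set (\bar R) :=
  [set a | exists (T : R) w x,
    [/\ 0 < T,
        controls U w /\ (forall t, w (t + T) = w t),
        (forall t, 0 <= t ->
           phi (t + T) x w = phi t x w /\ interior D (phi t x w)),
        (exists C, [/\ compact C, C `<=` interior U & w @` `[0, T] `<=` C])
      & a = (T^-1 * action T f w)%:E]].

End control_system.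

(* Main.v *)
(** By maximality, a trajectory that starts and ends in the control
    set [D] stays in [D] in between, so a control only has to bring points back
    to [D] at suitable times. Fix a periodic pair [(w0, x0)] with
    [x0] interior to [D], and a large multiple [T] of its period. In adapted
    real coordinates the image of a small cube around [x0] under the linear flow
    for time [T] is covered by [N = exp (T (h + o(1)))] translates of the same
    cube, where [h] is the sum of the positive real parts of the eigenvalues with
    multiplicity; this only needs a real block-triangular form with conformal
    blocks of size 1 or 2, the off-diagonal blocks being killed by rescaling.
    By controllability (invertible Gramian) each translate is shifted back onto
    the cube by a small perturbation of [w0]. Hence [N ^ j] controls close to [w0]
    keep the cube in [D] up to time [j T], and by compactness finitely many controls
    steer [K] into the cube in bounded time. *)
Require Import Defs.
From HB Require Import structures.
From mathcomp Require Import all_boot all_order all_algebra.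
From mathcomp Require Import all_classical all_reals all_analysis.
From mathcomp.real_closed Require Import complex.
From mathcomp Require Import measurable_realfun ring lra.
Set Implicit Arguments.
Unset Strict Implicit.
Unset Printing Implicit Defensive.
Import Order.TTheory GRing.Theory Num.Theory.
Import numFieldNormedType.Exports.
Local Open Scope classical_set_scope.
Local Open Scope ring_scope.

(** * The matrix exponential *)

(** The returning controls stay close to [w0] because of scale invariance. The covering count
    concerns the linear flow alone and is the same for every size [r] of the cube around [x0], while
    the errors to be corrected are proportional to [r]; shrinking [r] once the covering is fixed
    keeps the perturbed controls in [U] and their cost near that of [w0]. Each return ends in the
    very cube in which it began, so returns iterate without loss. The covering constant must not
    depend on time: it enters once per return, hence to the power [j], and is absorbed by a large
    return time [T']. The adapted coordinates may vary with [T'], which is fixed before the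
    iteration; this is what allows off-diagonal blocks to be rescaled away without a Jordan form. *)

Lemma le_mx_norm (R : realType) m n (M : 'M[R]_(m, n)) i j : `|M i j| <= `|M|.
Proof.
rewrite [leRHS]/Num.norm/= mx_normrE; apply/bigmax_geP; right => /=.
by exists (i, j).
Qed.

Lemma mx_norm_le (R : realType) m n (M : 'M[R]_(m, n)) (c : R) : 0 <= c ->
  (forall i j, `|M i j| <= c) -> `|M| <= c.
Proof.
move=> c0 Mc; rewrite [leLHS]/Num.norm/= mx_normrE; apply/bigmax_leP.
by split => // -[i j] _; exact: Mc.
Qed.

Lemma mx_norm_mul (R : realType) m n p (M : 'M[R]_(m, n)) (N : 'M[R]_(n, p)) :
  `|M *m N| <= n%:R * `|M| * `|N|.
Proof.
apply: mx_norm_le => [|i j]; first by rewrite !mulr_ge0.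
rewrite mxE (le_trans (ler_norm_sum _ _ _))//.
rewrite (le_trans (ler_sum _ (G := fun=> `|M| * `|N|) _))//.
  by move=> k _; rewrite normrM ler_pM// le_mx_norm.
by rewrite sumr_const card_ord -[leLHS]mulr_natl mulrA.
Qed.

Lemma cvg_mx (R : realType) m n (u : nat -> 'M[R]_(m, n)) (L : 'M[R]_(m, n)) :
  (forall i j, u k i j @[k --> \oo] --> L i j) -> u @ \oo --> L.
Proof.
move=> uL; apply/cvgrPdist_le => e e0.
have : \forall k \near \oo, forall ij : 'I_m * 'I_n, `|L ij.1 ij.2 - u k ij.1 ij.2| <= e.
  by apply: filter_forall => -[a b] /=; move/cvgrPdist_le : (uL a b); apply.
apply: filterS => k Hk; apply: mx_norm_le => [|i j]; first exact: ltW.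
by rewrite !mxE; exact: (Hk (i, j)).
Qed.

Lemma cvg_mx_coord (R : realType) m n (u : nat -> 'M[R]_(m, n)) (L : 'M[R]_(m, n)) i j :
  u @ \oo --> L -> u k i j @[k --> \oo] --> L i j.
Proof. move=> uL.
apply: (@cvg_comp _ _ _ u (fun M : 'M[R]_(m, n) => M i j) _ (nbhs L) (nbhs (L i j))) => //.
exact: coord_continuous. Qed.

Lemma cvg_sumr (R : realType) T (F : set_system T) (I : Type) (r : seq I)
    (P : pred I) (f : I -> T -> R) (a : I -> R) : Filter F ->
  (forall i, P i -> f i x @[x --> F] --> a i) ->
  \sum_(i <- r | P i) f i x @[x --> F] --> \sum_(i <- r | P i) a i.
Proof. by move=> FF; apply: cvg_big => //; exact: add_continuous. Qed.

(** The left factor [M] keeps the family closed under termwise differentiation, which replaces [M]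
    by [M *m A]. *)
Definition exp_coef (R : realType) (d : nat) (A M : 'M[R]_d) (i j : 'I_d) (k : nat) : R :=
  (M *m A ^+ k) i j / k`!%:R.

Lemma pseries_diffs_exp_coef (R : realType) d (A M : 'M[R]_d) i j :
  pseries_diffs (exp_coef A M i j) = exp_coef A (M *m A) i j.
Proof.
apply/funext => k; rewrite /pseries_diffs /exp_coef exprS mulmxA.
by rewrite factS natrM invfM mulrCA mulVKf// pnatr_eq0.
Qed.

Lemma mx_norm_exp (R : realType) d (A : 'M[R]_d) k :
  `|A ^+ k| <= (d%:R * `|A|) ^+ k.
Proof.
elim: k => [|k IH].
  rewrite !expr0; apply: mx_norm_le => // i j.
  by rewrite mxE; case: (i == j); rewrite /= ?normr1 ?normr0.
rewrite !exprS (le_trans (mx_norm_mul _ _))// ler_wpM2l// mulr_ge0//.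
Qed.

Lemma is_cvg_pseries_exp_coef (R : realType) d (A M : 'M[R]_d) i j (t : R) :
  cvgn (pseries (exp_coef A M i j) t).
Proof.
apply: normed_cvg.
pose x := d%:R * `|A| * `|t|; pose c := d%:R * `|M|.
have c0 : 0 <= c by rewrite mulr_ge0.
have x0 : 0 <= x by rewrite !mulr_ge0.
apply: (@series_le_cvg _ _ (c *: exp_coeff x)).
- by move=> k /=.
- by move=> k; rewrite mulr_ge0// exp_coeff_ge0.
- move=> k; have -> : (c *: exp_coeff x) k = c * (x ^+ k / k`!%:R) by [].
  rewrite /= /exp_coef !normrM normfV normr_nat.
  rewrite [x ^+ k]exprMn normrX [leRHS]mulrA mulrAC.
  apply: ler_wpM2r; first by rewrite invr_ge0.
  rewrite [leRHS]mulrA; apply: ler_wpM2r; first exact: exprn_ge0.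
  rewrite (le_trans (le_mx_norm _ _ _))// (le_trans (mx_norm_mul _ _))//.
  by rewrite ler_wpM2l// mx_norm_exp.
- by apply: is_cvg_seriesZ; exact: is_cvg_series_exp_coeff.
Qed.

Lemma pseries_exp_coef_mul (R : realType) d (A M : 'M[R]_d) i j (t : R) n :
  pseries (exp_coef A M i j) t n =
  \sum_l M i l * pseries (exp_coef A 1%:M l j) t n.
Proof.
rewrite /pseries /series /=.
under [RHS]eq_bigr do rewrite mulr_sumr.
rewrite [RHS]exchange_big /=; apply: eq_bigr => k _.
rewrite /exp_coef mxE !mulr_suml; apply: eq_bigr => l _.
by rewrite mul1mx !mulrA.
Qed.

Lemma exprZmx (R : realType) d (A : 'M[R]_d) (t : R) k :
  (t *: A) ^+ k = t ^+ k *: A ^+ k.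
Proof.
elim: k => [|k IH]; first by rewrite !expr0 scale1r.
by rewrite !exprS IH -[LHS]/(_ *m _) -scalemxAl -scalemxAr scalerA.
Qed.

Lemma series_exp_coef (R : realType) d (A : 'M[R]_d) i j (t : R) n :
  (series (fun k => (k`!%:R)^-1 *: (t *: A) ^+ k) n) i j =
  pseries (exp_coef A 1%:M i j) t n.
Proof.
rewrite /series /pseries /= /series/= summxE; apply: eq_bigr => k _.
rewrite mxE exprZmx mxE /exp_coef mul1mx.
by rewrite mulrC [_ * t ^+ k]mulrC -mulrA mulrC [_ * t ^+ k]mulrC !mulrA.
Qed.

Lemma cvg_series_expmx (R : realType) d (A : 'M[R]_d) (t : R) :
  series (fun k => (k`!%:R)^-1 *: (t *: A) ^+ k) @ \oo --> expmx (t *: A).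
Proof.
pose L := \matrix_(i, j) limn (pseries (exp_coef A 1%:M i j) t).
have H : series (fun k => (k`!%:R)^-1 *: (t *: A) ^+ k) @ \oo --> L.
  apply: cvg_mx => i j; rewrite mxE.
  under eq_fun do rewrite series_exp_coef.
  exact: is_cvg_pseries_exp_coef.
by rewrite (_ : expmx _ = L)//; exact/cvg_lim.
Qed.

Lemma expmxE (R : realType) d (A : 'M[R]_d) (t : R) i j :
  expmx (t *: A) i j = limn (pseries (exp_coef A 1%:M i j) t).
Proof.
apply/esym/cvg_lim => //.
rewrite (_ : pseries _ t =
    fun n => (series (fun k => (k`!%:R)^-1 *: (t *: A) ^+ k) n) i j); last first.
  by apply/funext => n; rewrite series_exp_coef.
exact: cvg_mx_coord (@cvg_series_expmx R d A t).
Qed.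

Lemma expmx_mulE (R : realType) d (A M : 'M[R]_d) (t : R) i j :
  limn (pseries (exp_coef A M i j) t) = (M *m expmx (t *: A)) i j.
Proof.
apply/cvg_lim => //; rewrite mxE.
rewrite (_ : pseries _ t =
    fun n => \sum_l M i l * pseries (exp_coef A 1%:M l j) t n); last first.
  by apply/funext => n; rewrite pseries_exp_coef_mul.
apply: cvg_sumr => l _; apply: cvgMl_tmp; rewrite expmxE.
exact: is_cvg_pseries_exp_coef.
Qed.

Definition is_derive_mx (R : realType) m n (X : R -> 'M[R]_(m, n)) (t : R)
  (X' : 'M[R]_(m, n)) := forall i j, is_derive t 1 (fun s => X s i j) (X' i j).

Lemma is_derive_mx_expmx (R : realType) d (A : 'M[R]_d) (t : R) :
  is_derive_mx (fun s => expmx (s *: A)) t (A *m expmx (t *: A)).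
Proof.
move=> i j.
have -> : (fun s => expmx (s *: A) i j) =
          (fun s => limn (pseries (exp_coef A 1%:M i j) s)).
  by apply/funext => s; rewrite expmxE.
have := @pseries_snd_diffs R (exp_coef A 1%:M i j) (`|t| + 1) t.
rewrite !pseries_diffs_exp_coef !mul1mx -(expmx_mulE A A); apply.
- exact: is_cvg_pseries_exp_coef.
- exact: is_cvg_pseries_exp_coef.
- exact: is_cvg_pseries_exp_coef.
- by rewrite [ltRHS]ger0_norm ?addr_ge0// ltrDl.
Qed.

Lemma is_derive_mx_mul (R : realType) m n p (X : R -> 'M[R]_(m, n))
  (Y : R -> 'M[R]_(n, p)) (t : R) X' Y' :
  is_derive_mx X t X' -> is_derive_mx Y t Y' ->
  is_derive_mx (fun s => X s *m Y s) t (X' *m Y t + X t *m Y').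
Proof.
move=> dX dY i j.
have -> : (fun s => (X s *m Y s) i j) =
    \sum_(k < n) ((fun s => X s i k) * (fun s => Y s k j)).
  by apply/funext => s; rewrite mxE fct_sumE.
rewrite !mxE -big_split /=; apply: is_derive_sum => k.
apply: is_derive_eq; first exact: is_deriveM.
by rewrite [LHS]addrC [X in X + _]mulrC.
Qed.

Lemma is_derive_mx_cst (R : realType) m n (M : 'M[R]_(m, n)) (t : R) :
  is_derive_mx (fun=> M) t 0.
Proof. by move=> i j; rewrite mxE; exact: is_derive_cst. Qed.

Lemma is_derive_mx_mull (R : realType) m n p (M : 'M[R]_(m, n))
  (Y : R -> 'M[R]_(n, p)) (t : R) Y' :
  is_derive_mx Y t Y' -> is_derive_mx (fun s => M *m Y s) t (M *m Y').
Proof.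
move=> dY; rewrite -[M *m Y']add0r -(mul0mx _ (Y t)).
exact: is_derive_mx_mul (is_derive_mx_cst _ _) dY.
Qed.

Lemma is_derive_mx_mulr (R : realType) m n p (M : 'M[R]_(n, p))
  (Y : R -> 'M[R]_(m, n)) (t : R) Y' :
  is_derive_mx Y t Y' -> is_derive_mx (fun s => Y s *m M) t (Y' *m M).
Proof.
move=> dY; rewrite -[Y' *m M]addr0 -(mulmx0 _ (Y t)).
exact: is_derive_mx_mul dY (is_derive_mx_cst _ _).
Qed.

Lemma is_derive_mx_0_is_cst (R : realType) m n (X : R -> 'M[R]_(m, n)) (s t : R) :
  (forall t, is_derive_mx X t 0) -> X s = X t.
Proof.
move=> dX; apply/matrixP => i j.
apply: (is_derive_0_is_cst (f := fun s => X s i j)) => u.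
by have := dX u i j; rewrite mxE.
Qed.

Lemma comm_expmx (R : realType) d (A : 'M[R]_d) (t : R) :
  A *m expmx (t *: A) = expmx (t *: A) *m A.
Proof.
apply/matrixP => i j; rewrite -expmx_mulE; apply/cvg_lim => //; rewrite mxE.
have -> : pseries (exp_coef A A i j) t =
    fun n => \sum_l pseries (exp_coef A 1%:M i l) t n * A l j.
  apply/funext => n; rewrite /pseries /series /=.
  under [RHS]eq_bigr do rewrite mulr_suml.
  rewrite [RHS]exchange_big /=; apply: eq_bigr => k _.
  have AkA : A *m A ^+ k = A ^+ k *m A by rewrite -[LHS](exprS A k) exprSr.
  rewrite /exp_coef AkA mxE !mulr_suml; apply: eq_bigr => l _.
  by rewrite mul1mx -!mulrA; congr (_ * _); rewrite mulrC mulrA.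
apply: cvg_sumr => l _; apply: cvgMr_tmp; rewrite expmxE.
exact: is_cvg_pseries_exp_coef.
Qed.

Lemma expmx0 (R : realType) d (A : 'M[R]_d) : expmx (0 *: A) = 1%:M.
Proof.
rewrite scale0r; apply: cvg_lim => //.
apply: (@cvg_near_cst _ _ _ _ _ _ _); exists 1%N => // n /= n0.
rewrite /series /= -(prednK n0) big_nat_recl// big1 ?addr0.
  by rewrite fact0 invr1 scale1r expr0.
by move=> k _; rewrite expr0n scaler0.
Qed.

(* Unification would otherwise unfold the limit defining [expmx]. *)
Local Opaque expmx.

Lemma expmxN_mul (R : realType) d (A : 'M[R]_d) (t : R) :
  expmx (t *: A) *m expmx (t *: - A) = 1%:M.
Proof.
rewrite -[RHS](mul1mx 1%:M) -{1}(expmx0 A) -(expmx0 (- A)).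
apply: (is_derive_mx_0_is_cst (X := fun s => expmx (s *: A) *m expmx (s *: - A))) => u.
have := is_derive_mx_mul (is_derive_mx_expmx A u) (is_derive_mx_expmx (- A) u).
by rewrite comm_expmx mulNmx mulmxN -!mulmxA subrr.
Qed.

(** The integrating factor e^(-tA) turns [X] into a constant. The later identities for the
    exponential rest on this uniqueness: both sides solve the same linear equation with the same
    initial value. *)
Lemma linear_ode_unique (R : realType) d n (A : 'M[R]_d) (X : R -> 'M[R]_(d, n)) :
  (forall t, is_derive_mx X t (A *m X t)) ->
  forall t, X t = expmx (t *: A) *m X 0.
Proof.
move=> dX t.
have : expmx (t *: - A) *m X t = expmx (0 *: - A) *m X 0.
  apply: (is_derive_mx_0_is_cst (X := fun s => expmx (s *: - A) *m X s)) => u.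
  have := is_derive_mx_mul (is_derive_mx_expmx (- A) u) (dX u).
  by rewrite comm_expmx mulmxN mulNmx -!mulmxA addrC subrr.
rewrite expmx0 mul1mx => <-.
by rewrite mulmxA expmxN_mul mul1mx.
Qed.

(** A rectangular [W] treats invariant subspaces, quotients and changes of basis at once. *)
Lemma expmx_intertwine (R : realType) n d (A : 'M[R]_d) (B : 'M[R]_n)
    (W : 'M[R]_(n, d)) (t : R) :
  W *m A = B *m W -> W *m expmx (t *: A) = expmx (t *: B) *m W.
Proof.
move=> WA; rewrite -[in RHS](mulmx1 W) -(expmx0 A).
apply: (linear_ode_unique (X := fun t => W *m expmx (t *: A))) => u.
by rewrite mulmxA -WA -mulmxA; exact/is_derive_mx_mull/is_derive_mx_expmx.
Qed.

Lemma expmxD (R : realType) d (A : 'M[R]_d) (s t : R) :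
  expmx ((s + t) *: A) = expmx (s *: A) *m expmx (t *: A).
Proof.
rewrite -[in RHS](add0r t).
apply: (linear_ode_unique (X := fun s => expmx ((s + t) *: A))) => u i j.
rewrite (_ : (fun s => expmx ((s + t) *: A) i j) =
    (fun s => expmx (s *: A) i j) \o shift t)//.
rewrite -[_ i j]mulr1; apply: is_derive1_comp; last exact: is_derive_shift.
exact: is_derive_mx_expmx.
Qed.

Lemma is_derive_mx_tr (R : realType) m n (X : R -> 'M[R]_(m, n)) (t : R) X' :
  is_derive_mx X t X' -> is_derive_mx (fun s => (X s)^T) t X'^T.
Proof.
move=> dX i j; rewrite mxE; have := dX j i; congr (is_derive _ _ _ _).
by apply/funext => s; rewrite mxE.
Qed.

Lemma expmx_scalar (R : realType) n (a t : R) :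
  expmx (t *: a%:M : 'M[R]_n) = (expR (t * a))%:M.
Proof.
rewrite -[LHS]mulmx1.
have -> : 1%:M = (expR (0 * a))%:M :> 'M[R]_n by rewrite mul0r expR0.
apply/esym/(linear_ode_unique (X := fun t => (expR (t * a))%:M)) => u i j.
rewrite -scalar_mxM mxE.
rewrite (_ : (fun s => (expR (s * a))%:M i j) =
    ((i == j)%:R : R) *: (expR \o ( *%R^~ a))); last first.
  by apply/funext => s; rewrite mxE /=; case: (i == j); rewrite /= ?scale1r ?scale0r.
have -> : (a * expR (u * a)) *+ (i == j) = (i == j)%:R *: (expR (u * a) * a).
  by case: (i == j); rewrite /= ?scale1r ?scale0r// mulrC.
apply: is_deriveZ; apply: is_derive1_comp.
rewrite (_ : *%R^~ a = a \*: (@id R)); last first.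
  by apply/funext => x /=; rewrite mulrC.
by apply: is_derive_eq; rewrite [LHS]mulr1.
Qed.

(** Since the symmetric part of [A] is the scalar [a], the product solves Y' = 2aY: the flow is
    e^(ta) times an isometry. Real eigenvalues and rotation-scaling blocks are both of this kind. *)
Lemma expmx_conformal (R : realType) n (A : 'M[R]_n) (a t : R) :
  A^T + A = (a + a)%:M ->
  (expmx (t *: A))^T *m expmx (t *: A) = (expR (t * (a + a)))%:M.
Proof.
move=> AA; rewrite -expmx_scalar -[RHS]mulmx1.
have -> : 1%:M = (expmx (0 *: A))^T *m expmx (0 *: A).
  by rewrite expmx0 trmx1 mulmx1.
apply: (linear_ode_unique (X := fun t => (expmx (t *: A))^T *m expmx (t *: A))) => u.
have := is_derive_mx_mul (is_derive_mx_tr (is_derive_mx_expmx A u)) (is_derive_mx_expmx A u).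
by rewrite trmx_mul -mulmxA -mulmxDr -mulmxDl AA !mul_scalar_mx -scalemxAr.
Qed.

Lemma expmx_coord_continuous (R : realType) d (A : 'M[R]_d) i j :
  continuous (fun t : R => expmx (t *: A) i j).
Proof.
move=> t; have [dX _] := is_derive_mx_expmx A t i j.
exact/differentiable_continuous/derivable1_diffP.
Qed.

(** * Covering numbers of linear flows *)

Definition covers (R : realType) n (M : 'M[R]_n) (r : R) (F : seq 'cV[R]_n) :=
  forall z : 'cV[R]_n, `|z| <= 1 -> exists2 p, p \in F & `|M *m z - p| <= r.

(** The coordinates [P], [Q] may depend on [t], the constant [C] may not. All radii [r] are demanded
    because the block induction covers the second block at half the radius. *)
Definition flow_covering (R : realType) n (A : 'M[R]_n) (h : R) :=
  forall r : R, 0 < r -> exists2 C : R, 0 < C & forall t : R, 0 <= t ->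
    exists (P Q : 'M[R]_n) F, [/\ P *m Q = 1%:M, (size F)%:R <= C * expR (t * h) &
                     covers (P *m expmx (t *: A) *m Q) r F].

Lemma cube_grid (R : realType) n (c r : R) : 0 <= c -> 0 < r ->
  exists2 F : seq 'cV[R]_n, (size F)%:R <= (2 * c / r + 1) ^+ n &
    forall y : 'cV_n, `|y| <= c -> exists2 p, p \in F & `|y - p| <= r.
Proof.
move=> c0 r0; pose m := Num.truncn (2 * c / r).
have cr0 : 0 <= 2 * c / r by rewrite divr_ge0 ?mulr_ge0// ltW.
pose pt (g : {ffun 'I_n -> 'I_m.+1}) : 'cV[R]_n := \col_i (- c + r * (g i)%:R).
exists [seq pt g | g : {ffun 'I_n -> 'I_m.+1}].
  rewrite size_map -cardE card_ffun !card_ord natrX lerXn2r ?nnegrE ?addr_ge0//.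
  by rewrite -natr1 lerD2r; case/andP : (truncn_itv cr0).
move=> y yc.
have yi i : - c <= y i ord0 <= c.
  by rewrite -ler_norml; exact: le_trans (le_mx_norm _ _ _) yc.
have k0 i : 0 <= (y i ord0 + c) / r.
  by have /andP[? _] := yi i; apply: divr_ge0 (ltW r0); lra.
have km i : (Num.truncn ((y i ord0 + c) / r) < m.+1)%N.
  rewrite ltnS le_truncn// ler_pM2r ?invr_gt0//.
  by have /andP[_ ?] := yi i; rewrite mulr_natl mulr2n lerD2r.
exists (pt [ffun i => Ordinal (km i)]).
  by apply/mapP; eexists; [exact: mem_enum|].
apply: mx_norm_le => [|i j]; first exact: ltW.
rewrite !mxE ffunE/= ord1.
have /andP[h1] := truncn_itv (k0 i).
move: h1; rewrite ler_pdivlMr// => h1.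
rewrite ltr_pdivrMr// -natr1 [X in _ < X]mulrDl mul1r => h2.
by rewrite ler_norml; apply/andP; split; lra.
Qed.

Lemma flow_covering_conj (R : realType) n (A G H : 'M[R]_n) (h : R) :
  G *m H = 1%:M -> flow_covering (G *m A *m H) h -> flow_covering A h.
Proof.
move=> GH cov r r0; have [C C0 HC] := cov r r0; exists C; first exact: C0.
move=> t t0; have [P [Q [F [PQ sF cF]]]] := HC t t0.
exists (P *m G), (H *m Q), F; split => //.
  by rewrite mulmxA -(mulmxA P) GH mulmx1.
have GA : G *m A = (G *m A *m H) *m G.
  by rewrite -mulmxA (mulmx1C GH) mulmx1.
have E := expmx_intertwine t GA.
have -> : P *m G *m expmx (t *: A) *m (H *m Q) =
    P *m expmx (t *: (G *m A *m H)) *m Q; last exact: cF.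
  rewrite -[P *m G *m _]mulmxA E !mulmxA -(mulmxA _ G H) GH.
  by rewrite mulmx1.
Qed.

(** The block row (1 0) and the block column (0 1) intertwine the matrix with its diagonal blocks.
    The block [X] stays unspecified, since only its finiteness at a fixed time matters. *)
Lemma expmx_lblock (R : realType) n1 n2 (A1 : 'M[R]_n1) (A2 : 'M[R]_n2) A21 (t : R) :
  exists X, expmx (t *: block_mx A1 0 A21 A2) =
            block_mx (expmx (t *: A1)) 0 X (expmx (t *: A2)).
Proof.
set A := block_mx _ _ _ _; set E := expmx (t *: A).
have : row_mx 1%:M 0 *m A = A1 *m row_mx 1%:M 0.
  by rewrite mul_row_block !mul1mx !mul0mx !addr0 mul_mx_row mulmx1 mulmx0.
move=> /(expmx_intertwine t); rewrite -/E => E1.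
have : col_mx 0 1%:M *m A2 = A *m col_mx 0 1%:M.
  by rewrite mul_block_col !mulmx0 !mul0mx !mulmx1 !add0r mul_col_mx mul1mx mul0mx.
move=> /(expmx_intertwine t); rewrite -/E => E2.
exists (dlsubmx E); rewrite -[LHS]submxK.
move: E1; rewrite -{1}(submxK E) mul_row_block !mul1mx !mul0mx !addr0.
rewrite mul_mx_row mulmx1 mulmx0 => /eq_row_mx[-> ->].
move: E2; rewrite -{1}(submxK E) mul_block_col !mulmx0 !mulmx1 !add0r.
by rewrite mul_col_mx mul1mx mul0mx => /eq_col_mx[_ ->].
Qed.

Lemma norm_col_mx_le (R : realType) n1 n2 (x : 'cV[R]_n1) (y : 'cV[R]_n2) (c : R) :
  (`|col_mx x y| <= c) = (`|x| <= c) && (`|y| <= c).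
Proof.
apply/idP/andP => [xyc|[xc yc]].
  have c0 : 0 <= c by exact: le_trans (normr_ge0 _) xyc.
  split; apply: mx_norm_le => // i j; apply: le_trans xyc.
    by rewrite -(col_mxEu x y); exact: le_mx_norm.
  by rewrite -(col_mxEd x y); exact: le_mx_norm.
apply: mx_norm_le; first exact: le_trans (normr_ge0 _) xc.
move=> i j; rewrite mxE; case: (fintype.split i) => k.
  exact: le_trans (le_mx_norm _ _ _) xc.
exact: le_trans (le_mx_norm _ _ _) yc.
Qed.

(* Shrinking the second block of coordinates makes the off-diagonal block of the
   flow negligible. *)
Lemma flow_covering_lblock (R : realType) n1 n2 (A1 : 'M[R]_n1) (A2 : 'M[R]_n2)
    A21 (h1 h2 : R) :
  flow_covering A1 h1 -> flow_covering A2 h2 ->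
  flow_covering (block_mx A1 0 A21 A2) (h1 + h2).
Proof.
move=> c1 c2 r r0.
have r20 : 0 < r / 2 by rewrite divr_gt0.
have [C1 C10 H1] := c1 r r0; have [C2 C20 H2] := c2 _ r20.
exists (C1 * C2); first by rewrite mulr_gt0.
move=> t t0.
have [P1 [Q1 [F1 [PQ1 sF1 cF1]]]] := H1 t t0.
have [P2 [Q2 [F2 [PQ2 sF2 cF2]]]] := H2 t t0.
have [X ->] := expmx_lblock A1 A2 A21 t.
pose Y := P2 *m X *m Q1.
(* Chosen so that the off-diagonal term, at most [eta * (n1 * |Y|)], fits into the spare [r / 2];
   the added 1 keeps the denominator positive. As [Y] depends on [t], so do the coordinates. *)
pose eta := r / 2 / (n1%:R * `|Y| + 1).
have den0 : 0 < n1%:R * `|Y| + 1 by rewrite ltr_wpDl// mulr_ge0.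
have eta0 : 0 < eta by rewrite divr_gt0.
exists (block_mx P1 0 0 (eta *: P2)), (block_mx Q1 0 0 (eta^-1 *: Q2)).
exists [seq col_mx p1 p2 | p1 <- F1, p2 <- F2]; split.
- rewrite mulmx_block !mulmx0 !mul0mx !addr0 !add0r PQ1 -scalemxAl -scalemxAr.
  by rewrite scalerA divff ?gt_eqF// scale1r PQ2 scalar_mx_block.
- rewrite size_allpairs natrM mulrDr expRD mulrACA.
  by apply: ler_pM.
- move=> z; rewrite -{1}(vsubmxK z) norm_col_mx_le => /andP[z1 z2].
  have [p1 p1F p1r] := cF1 _ z1; have [p2 p2F p2r] := cF2 _ z2.
  exists (col_mx p1 p2); first by apply/allpairsP; exists (p1, p2).
  rewrite !mulmx_block !mulmx0 !mul0mx !addr0 !add0r.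
  rewrite -(vsubmxK z) mul_block_col mul0mx (mul0mx _ (dsubmx z)) addr0.
  have -> : eta *: P2 *m X *m Q1 *m usubmx z = eta *: (Y *m usubmx z).
    by rewrite /Y !scalemxAl.
  have -> : eta *: P2 *m expmx (t *: A2) *m (eta^-1 *: Q2) *m dsubmx z =
      P2 *m expmx (t *: A2) *m Q2 *m dsubmx z.
    by rewrite -scalemxAr -!scalemxAl scalerA mulVf ?gt_eqF// scale1r.
  rewrite opp_col_mx add_col_mx norm_col_mx_le p1r/=.
  rewrite -addrA (le_trans (ler_normD _ _))// [r]splitr lerD//.
  rewrite normrZ gtr0_norm// (le_trans (ler_wpM2l (ltW eta0) (mx_norm_mul _ _)))//.
  rewrite /eta mulrAC ler_pdivrMr// ler_pM2l//.
  by rewrite (le_trans (ler_wpM2l _ z1)) ?mulr1 ?lerDl// mulr_ge0.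
Qed.

(** On the unit cube the squared Euclidean norm is at most n, hence at most n^2, and the flow scales
    the norm by e^(ta); with b = max(0, a) the image lies in a cube of radius n e^(tb). The grid
    then has at most (2n e^(tb)/r + 1)^n points, and e^(tb) >= 1 lets the added 1 be absorbed into
    the constant. *)
Lemma flow_covering_conformal (R : realType) n (A : 'M[R]_n) (a : R) :
  A^T + A = (a + a)%:M -> flow_covering A (n%:R * Num.max 0 a).
Proof.
move=> AA r r0.
have c0 : 0 <= 2 * n%:R / r by rewrite divr_ge0 ?mulr_ge0// ltW.
exists ((2 * n%:R / r + 1) ^+ n); first by rewrite exprn_gt0// ltr_wpDl.
move=> t t0; set b := Num.max 0 a.
have tb0 : 0 <= t * b by rewrite mulr_ge0// le_max lexx.
have [F sF cF] := @cube_grid R n (n%:R * expR (t * b)) r (mulr_ge0 (ler0n _ _) (expR_ge0 _)) r0.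
exists 1%:M, 1%:M, F; split.
- by rewrite mulmx1.
- apply: le_trans sF _.
  rewrite (_ : t * (n%:R * b) = n%:R * (t * b)); last by rewrite mulrCA.
  rewrite expRM_natl -exprMn lerXn2r ?nnegrE//.
  + by rewrite addr_ge0// divr_ge0 ?(ltW r0)// mulr_ge0// mulr_ge0// expR_ge0.
  + by rewrite mulr_ge0 ?expR_ge0// addr_ge0.
  + rewrite [leRHS]mulrDl mul1r; apply: lerD; first by rewrite mulrA mulrAC.
    by rewrite -expR0 ler_expR.
- move=> z z1; rewrite mul1mx mulmx1; apply: cF.
  set y := expmx _ *m z.
  have yz : \sum_i y i ord0 ^+ 2 = expR (t * (a + a)) * \sum_i z i ord0 ^+ 2.
    have := expmx_conformal t AA.
    move/(congr1 (fun M => (z^T *m M *m z) ord0 ord0)).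
    rewrite mulmxA -trmx_mul -mulmxA -/y mul_mx_scalar -scalemxAl !mxE.
    under eq_bigr do rewrite mxE -expr2.
    by under [in RHS]eq_bigr do rewrite mxE -expr2.
  have yn : \sum_i y i ord0 ^+ 2 <= (n%:R * expR (t * b)) ^+ 2.
    rewrite yz exprMn mulrC ler_pM ?expR_ge0//.
    + by rewrite sumr_ge0// => i _; exact: sqr_ge0.
    + rewrite (le_trans (ler_sum _ (G := fun=> 1) _))//.
        move=> i _; rewrite -[_ ^+ 2]ger0_norm ?sqr_ge0// normrX expr_le1//.
        exact: le_trans (le_mx_norm _ _ _) z1.
      rewrite sumr_const card_ord -natrX ler_nat; case: (n) => // k.
      by rewrite -mulnn leq_pmull.
    + rewrite expr2 -expRD -mulrDr ler_expR ler_wpM2l// lerD// /b le_max lexx ?orbT//.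
  have nb0 : 0 <= n%:R * expR (t * b) by rewrite mulr_ge0 ?expR_ge0.
  apply: mx_norm_le => // i j; rewrite ord1.
  rewrite -(ler_pXn2r (ltn0Sn 1)) ?nnegrE// -normrX ger0_norm ?sqr_ge0//.
  apply: le_trans yn; rewrite (bigD1 i)//= lerDl sumr_ge0// => k _.
  exact: sqr_ge0.
Qed.

(** * Real conformal blocks and the characteristic polynomial *)

Lemma Re_sum (R : rcfType) (I : Type) (r : seq I) (P : pred I) (F : I -> R[i]) :
  complex.Re (\sum_(i <- r | P i) F i) = \sum_(i <- r | P i) complex.Re (F i).
Proof. by apply: (big_morph (@complex.Re R)) => // -[a b] [c e]. Qed.

Lemma Im_sum (R : rcfType) (I : Type) (r : seq I) (P : pred I) (F : I -> R[i]) :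
  complex.Im (\sum_(i <- r | P i) F i) = \sum_(i <- r | P i) complex.Im (F i).
Proof. by apply: (big_morph (@complex.Im R)) => // -[a b] [c e]. Qed.

Lemma eigenvector_Re_Im (R : realType) d (A : 'M[R]_d) (u : 'rV[R[i]]_d) (l : R[i]) :
  u *m complex_mx A = l *: u ->
  map_mx (@complex.Re R) u *m A =
    complex.Re l *: map_mx (@complex.Re R) u - complex.Im l *: map_mx (@complex.Im R) u /\
  map_mx (@complex.Im R) u *m A =
    complex.Im l *: map_mx (@complex.Re R) u + complex.Re l *: map_mx (@complex.Im R) u.
Proof.
move=> uA; split; apply/rowP => j; have := congr1 (fun M : 'rV[R[i]]_d => M ord0 j) uA;
  rewrite !mxE.
- move/(congr1 (@complex.Re R)); rewrite Re_sum.
  have -> : complex.Re (l * u ord0 j) = complex.Re l * complex.Re (u ord0 j) -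
      complex.Im l * complex.Im (u ord0 j).
    by case: l {uA} => a b; case: (u ord0 j).
  move=> <-; apply: eq_bigr => k _; rewrite !mxE.
  by case: (u ord0 k) => a b /=; rewrite mulr0 subr0.
- move/(congr1 (@complex.Im R)); rewrite Im_sum.
  have -> : complex.Im (l * u ord0 j) = complex.Im l * complex.Re (u ord0 j) +
      complex.Re l * complex.Im (u ord0 j).
    by case: l {uA} => a b; case: (u ord0 j) => c e /=; ring.
  move=> <-; apply: eq_bigr => k _; rewrite !mxE.
  by case: (u ord0 k) => a b /=; rewrite mulr0 add0r.
Qed.

Lemma char_poly_conj (R : comUnitRingType) d (A G H : 'M[R]_d) :
  G *m H = 1%:M -> char_poly (G *m A *m H) = char_poly A.
Proof.
move=> GH; rewrite /char_poly /char_poly_mx.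
have GHp : map_mx polyC G *m map_mx polyC H = 1%:M.
  by rewrite -map_mxM GH map_mx1.
rewrite !map_mxM.
have -> : 'X%:M - map_mx polyC G *m map_mx polyC A *m map_mx polyC H =
  map_mx polyC G *m ('X%:M - map_mx polyC A) *m map_mx polyC H.
  by rewrite mulmxBr mulmxBl mul_mx_scalar -scalemxAl GHp scalemx1.
by rewrite !det_mulmx mulrAC -det_mulmx GHp det1 mul1r.
Qed.

Lemma char_poly_lblock (R : comUnitRingType) n1 n2 (A1 : 'M[R]_n1) (A2 : 'M[R]_n2) A21 :
  char_poly (block_mx A1 0 A21 A2) = char_poly A1 * char_poly A2.
Proof.
rewrite /char_poly /char_poly_mx map_block_mx scalar_mx_block.
rewrite opp_block_mx add_block_mx map_mx0 oppr0 addr0.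
by rewrite det_lblock.
Qed.

(** The rank factorization supplies the missing rows: [row_ebase W] is invertible, and [col_ebase W]
    corrects its first [k] rows into [W]. *)
Lemma row_free_complete (R : fieldType) k n (W : 'M[R]_(k, k + n)) :
  row_free W -> exists G H : 'M[R]_(k + n), G *m H = 1%:M /\ usubmx G = W.
Proof.
move=> /eqP rW; pose G := block_mx (col_ebase W) 0 0 1%:M *m row_ebase W.
have Gu : G \in unitmx.
  by rewrite unitmx_mul row_ebase_unit andbT unitmxE det_lblock det1 mulr1 -unitmxE col_ebase_unit.
exists G, (invmx G); split; first by rewrite mulmxV.
rewrite -[RHS]mulmx_ebase rW pid_mx_row /G -mul_usub_mx.
rewrite block_mxEv col_mxKu; congr (_ *m _).
by rewrite mul_mx_row mulmx1 mulmx0.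
Qed.

(** Roots are listed with repetition, so the sum is additive under concatenation, just as the
    characteristic polynomial is multiplicative over diagonal blocks. *)
Definition root_sum (R : rcfType) (s : seq R[i]) : R :=
  \sum_(l <- s) Num.max 0 (complex.Re l).

Lemma det_mx2 (R : comNzRingType) (M : 'M[R]_(1 + 1)) :
  \det M = ulsubmx M 0 0 * drsubmx M 0 0 - ursubmx M 0 0 * dlsubmx M 0 0.
Proof.
rewrite (expand_det_row _ (lshift 1 ord0)) big_split_ord /= !big_ord1.
rewrite /cofactor !det_mx11 !mxE /= !addn0 expr0 expr1 mulN1r mul1r mulrN.
congr (_ * M _ _ - _ * M _ _); exact/val_inj.
Qed.

Lemma char_poly_rot (R : realType) (a b : R) :
  char_poly (complex_mx (block_mx a%:M (- b)%:M b%:M a%:M : 'M[R]_(1 + 1))) =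
  \prod_(l <- [:: Complex a b; Complex a (- b)]) ('X - l%:P).
Proof.
rewrite !big_cons big_nil mulr1 /char_poly det_mx2.
rewrite /char_poly_mx /complex_mx !map_block_mx scalar_mx_block opp_block_mx add_block_mx.
rewrite block_mxKul block_mxKur block_mxKdl block_mxKdr !mxE /= !mulr1n.
have -> : Complex a b = real_complex R a + real_complex R b * Complex 0 1.
  by apply/eqP; rewrite eq_complex /= !(mulr0, mul0r, mulr1, addr0, add0r, subr0) !eqxx.
have -> : Complex a (- b) = real_complex R a - real_complex R b * Complex 0 1.
  apply/eqP; rewrite eq_complex /=.
  by rewrite !(mulr0, mul0r, mulr1, addr0, add0r, subr0, oppr0) !eqxx.
(* The imaginary unit is an indeterminate for [ring], so its square has to be substituted by
   hand. *)
have ii : (Complex 0 1)%:P * (Complex 0 1)%:P = - 1 :> {poly R[i]}.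
  by rewrite -polyCM -polyCN; congr (_%:P); rewrite -[LHS]expr2 sqr_i.
rewrite [real_complex R (- b)]rmorphN polyCB polyCD polyCM polyCN.
set P := (real_complex R a)%:P; set Q := (real_complex R b)%:P; set I := (Complex 0 1)%:P.
transitivity (('X - P) * ('X - P) - Q * Q * (I * I)); first by rewrite ii; ring.
ring.
Qed.

(** Split a complex row eigenvector as p + iq, with eigenvalue a + ib. If b = 0, a nonzero one of p,
    q spans an invariant line; otherwise p, q span an invariant plane on which [A] acts as a
    rotation-scaling matrix with symmetric part a and roots a + ib, a - ib. *)
Lemma real_invariant_block (R : realType) d (A : 'M[R]_d) : (0 < d)%N ->
  exists k (W : 'M[R]_(k, d)) (A1 : 'M[R]_k) (a : R) (s : seq R[i]),
  [/\ (0 < k)%N, row_free W, W *m A = A1 *m W, A1^T + A1 = (a + a)%:M &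
     char_poly (complex_mx A1) = \prod_(l <- s) ('X - l%:P) /\
     root_sum s = k%:R * Num.max 0 a].
Proof.
move=> d0; have [l /eigenvalueP[u uA u0]] := eigenvalue_closed (complex_mx A) d0.
have [] := eigenvector_Re_Im uA.
set p := map_mx (@complex.Re R) u; set q := map_mx (@complex.Im R) u.
case: l uA => a b uA /= pA qA.
have pq0 : (p != 0) || (q != 0).
  rewrite -negb_and; apply: contra u0 => /andP[/eqP/rowP p0 /eqP/rowP q0].
  apply/eqP/rowP => j; move: (p0 j) (q0 j); rewrite !mxE.
  by case: (u _ _) => x y /= -> ->.
have real1 (w : 'rV_d) : w != 0 -> w *m A = a *: w ->
  exists k (W : 'M[R]_(k, d)) (A1 : 'M[R]_k) (a : R) (s : seq R[i]),
  [/\ (0 < k)%N, row_free W, W *m A = A1 *m W, A1^T + A1 = (a + a)%:M &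
     char_poly (complex_mx A1) = \prod_(l <- s) ('X - l%:P) /\
     root_sum s = k%:R * Num.max 0 a].
  move=> w0 wA; exists 1%N, w, a%:M, a, [:: (real_complex R a)]; split => //.
  - by rewrite /row_free rank_rV w0.
  - by rewrite mul_scalar_mx.
  - by rewrite tr_scalar_mx raddfD.
  - rewrite /root_sum !big_seq1 mul1r; split => //.
    by rewrite /char_poly det_mx11 !mxE /= !mulr1n.
have [b0|b0] := eqVneq b 0.
  move: pA qA; rewrite b0 !scale0r subr0 add0r => pA qA.
  by case/orP : pq0 => ?; [exact: (real1 p)|exact: (real1 q)].
exists (1 + 1)%N, (col_mx p q), (block_mx a%:M (- b)%:M b%:M a%:M), a.
exists [:: Complex a b; Complex a (- b)]; split => //.
(* Independence of p, q: applying [A] to xp + yq = 0 gives yp = xq because b is nonzero, and the two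
   relations yield (x^2 + y^2)p = (x^2 + y^2)q = 0. *)
- rewrite -kermx_eq0; apply/eqP/row_matrixP => i.
  have := row_sub i (kermx (col_mx p q)); rewrite row0.
  set v := row i _ => /sub_kermxP.
  rewrite -(hsubmxK v) mul_row_col.
  rewrite [lsubmx v]mx11_scalar [rsubmx v]mx11_scalar.
  set x := lsubmx v 0 0; set y := rsubmx v 0 0.
  rewrite !mul_scalar_mx => xy.
  have yx : y *: p = x *: q.
    have := congr1 (mulmx^~ A) xy; rewrite mul0mx mulmxDl -!scalemxAl pA qA.
    rewrite scalerBr scalerDr !scalerA.
    have -> : (x * a) *: p - (x * b) *: q + ((y * b) *: p + (y * a) *: q) =
       a *: (x *: p + y *: q) + b *: (y *: p - x *: q).
      by apply/rowP => j; rewrite !mxE; ring.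
    rewrite xy scaler0 add0r => /eqP; rewrite scaler_eq0 (negbTE b0)/= subr_eq0.
    by move/eqP.
  have xyp : (x ^+ 2 + y ^+ 2) *: p = 0.
    have -> : (x ^+ 2 + y ^+ 2) *: p = x *: (x *: p) + y *: (y *: p).
      by apply/rowP => j; rewrite !mxE; ring.
    rewrite yx.
    have -> : x *: (x *: p) + y *: (x *: q) = x *: (x *: p + y *: q).
      by apply/rowP => j; rewrite !mxE; ring.
    by rewrite xy scaler0.
  have xyq : (x ^+ 2 + y ^+ 2) *: q = 0.
    have -> : (x ^+ 2 + y ^+ 2) *: q = x *: (x *: q) + y *: (y *: q).
      by apply/rowP => j; rewrite !mxE; ring.
    rewrite -yx.
    have -> : x *: (y *: p) + y *: (y *: q) = y *: (x *: p + y *: q).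
      by apply/rowP => j; rewrite !mxE; ring.
    by rewrite xy scaler0.
  have : x ^+ 2 + y ^+ 2 = 0.
    case/orP : pq0 => [p0|q0].
      by move/eqP: xyp; rewrite scaler_eq0 (negbTE p0) orbF => /eqP.
    by move/eqP: xyq; rewrite scaler_eq0 (negbTE q0) orbF => /eqP.
  move/eqP; rewrite paddr_eq0 ?sqr_ge0// !sqrf_eq0 => /andP[/eqP-> /eqP->].
  by apply/matrixP => i' j; rewrite !mxE; case: (fintype.split _) => k; rewrite !mxE mul0rn.
- rewrite mul_col_mx pA qA mul_block_col !mul_scalar_mx.
  by rewrite scaleNr.
- rewrite tr_block_mx !tr_scalar_mx add_block_mx -!raddfD /= addrN addNr raddf0.
  by rewrite [RHS]scalar_mx_block.
- rewrite char_poly_rot; split => //.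
  rewrite /root_sum !big_cons big_nil /= addr0.
  by rewrite [RHS]mulr_natl mulr2n.
Qed.

(** Induction on the dimension: one real invariant block is split off, and the lower right block is
    smaller. The factorization of the characteristic polynomial is carried along to identify the
    exponent. *)
Lemma flow_covering_exists (R : realType) d (A : 'M[R]_d) :
  exists s : seq R[i], char_poly (complex_mx A) = \prod_(l <- s) ('X - l%:P) /\
    flow_covering A (root_sum s).
Proof.
have [m] := ubnP d; elim: m d A => // m IH d A; rewrite ltnS => dm.
have [d0|d0] := posnP d.
  move: A; rewrite d0 => A; exists [::]; rewrite big_nil; split.
    by rewrite /char_poly det_mx00.
  rewrite /root_sum big_nil -(mul0r (Num.max 0 0)).
  apply: (@flow_covering_conformal R 0 A 0).
  by apply/matrixP => -[].
have [k [W [A1 [a [s [k0 rW WA conf [sA1 hs]]]]]]] := real_invariant_block A d0.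
have kd : (k <= d)%N by rewrite -(eqP rW) rank_leq_col.
have [n dE] : exists n, d = (k + n)%N by exists (d - k)%N; rewrite subnKC.
subst d; have [G [H [GH GW]]] := row_free_complete rW.
pose M := G *m A *m H.
have MW : usubmx M = row_mx A1 0.
  rewrite /M -mulmxA -mul_usub_mx GW mulmxA WA -mulmxA -GW mul_usub_mx GH.
  by rewrite scalar_mx_block block_mxEv col_mxKu mul_mx_row mulmx1 mulmx0.
have ME : M = block_mx A1 0 (dlsubmx M) (drsubmx M).
  by rewrite block_mxEv -MW /dlsubmx /drsubmx hsubmxK vsubmxK.
have [|s2 [sA2 cov2]] := IH n (drsubmx M).
  by apply: leq_trans dm; rewrite -{1}(add0n n) ltn_add2r.
exists (s ++ s2); rewrite big_cat /= -sA1 -sA2; split.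
  rewrite /complex_mx -!map_char_poly -rmorphM /=; congr (map_poly _ _).
  by rewrite -(char_poly_conj A GH) -/M {1}ME char_poly_lblock.
apply: flow_covering_conj GH _; rewrite -/M ME /root_sum big_cat /=.
apply: flow_covering_lblock cov2.
by rewrite -/(root_sum s) hs; exact: flow_covering_conformal.
Qed.

(** Grouping equal roots turns repetition into multiplicity, and a nonnegative factor passes through
    the maximum. *)
Lemma spectrum_sum (R : realType) d (A : 'M[R]_d) (s : seq R[i]) :
  char_poly (complex_mx A) = \prod_(l <- s) ('X - l%:P) ->
  \sum_(l \in spectrum A) Num.max 0 ((alg_mult A l)%:R * complex.Re l) = root_sum s.
Proof.
move=> sA.
have -> : spectrum A = [set` undup s].
  apply/seteqP; split=> l /=;
  by rewrite mem_undup /spectrum /= eigenvalue_root_char sA root_prod_XsubC.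
rewrite -fsbig_seq ?undup_uniq// /root_sum -[RHS]big_undup_iterop_count /=.
apply: eq_bigr => l _; rewrite /alg_mult sA mu_prod_XsubC.
rewrite -[RHS]/(Num.max 0 (complex.Re l) *+ count_mem l s).
by rewrite -[RHS]mulr_natl maxr_pMr// mulr0.
Qed.

(** * Integrals of bounded measurable functions *)

Local Notation mu := (@lebesgue_measure _) (only parsing).

(** A class that is stable under sums and products, consists of integrable functions, and contains
    the entries of controls with compact range. *)
Definition bounded_measurable (R : realType) (a b : R) (g : R -> R) :=
  measurable_fun `[a, b] g /\ exists M, forall t, a <= t <= b -> `|g t| <= M.

Lemma bounded_measurable_integrable (R : realType) (a b : R) g :
  bounded_measurable a b g -> mu.-integrable `[a, b] (EFin \o g).
Proof.
move=> [mg [M gM]]; apply: measurable_bounded_integrable => //.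
  by rewrite /= lebesgue_measure_itv/=; case: ifP => // _; rewrite -EFinB ltry.
exists M; split; first exact: num_real.
move=> x Mx t /=; rewrite in_itv/= => /gM/le_trans; apply; exact: ltW.
Qed.

Lemma bounded_measurable_cst (R : realType) (a b c : R) :
  bounded_measurable a b (fun=> c).
Proof. by split=> //; exists `|c|. Qed.

Lemma bounded_measurableD (R : realType) (a b : R) f g :
  bounded_measurable a b f -> bounded_measurable a b g ->
  bounded_measurable a b (fun t => f t + g t).
Proof.
move=> [mf [M fM]] [mg [N gN]]; split; first exact: measurable_funD.
exists (M + N) => t tab; rewrite (le_trans (ler_normD _ _))// lerD ?fM ?gN//.
Qed.

Lemma bounded_measurableM (R : realType) (a b : R) f g :
  bounded_measurable a b f -> bounded_measurable a b g ->
  bounded_measurable a b (fun t => f t * g t).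
Proof.
move=> [mf [M fM]] [mg [N gN]]; split; first exact: measurable_funM.
by exists (M * N) => t tab; rewrite normrM ler_pM ?fM ?gN.
Qed.

Lemma bounded_measurable_sum (R : realType) (a b : R) (I : Type) (r : seq I)
    (f : I -> R -> R) : (forall i, bounded_measurable a b (f i)) ->
  bounded_measurable a b (fun t => \sum_(i <- r) f i t).
Proof.
move=> bf; elim: r => [|i r IH].
  by under eq_fun do rewrite big_nil; exact: bounded_measurable_cst.
by under eq_fun do rewrite big_cons; exact: bounded_measurableD.
Qed.

Lemma bounded_measurable_continuous (R : realType) (a b : R) (g : R -> R) :
  continuous g -> bounded_measurable a b g.
Proof.
move=> cg; split.
  by apply: measurable_funTS; exact: continuous_measurable_fun.
have [M [_ HM]] := compact_bounded (continuous_compact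
  (continuous_subspaceT cg) (@segment_compact R a b)).
exists (M + 1) => t tab; apply: (HM (M + 1)); first by rewrite ltrDl.
by exists t => //=; rewrite in_itv.
Qed.

Lemma fine_lebesgue_measure_itv (R : realType) (s : R) : 0 <= s ->
  fine (lebesgue_measure (`[0, s]%classic : set R)) = s.
Proof.
move=> s0; rewrite /= lebesgue_measure_itv/= lte_fin.
by case: ltP => [_|ss]; rewrite ?oppr0 ?addr0//= (le_anti (introT andP (conj ss s0))).
Qed.

(** The pushforward of Lebesgue measure under a translation agrees with it on half-open intervals,
    hence everywhere. Extending [g] by zero makes it measurable on the whole line, as the
    pushforward formula requires. *)
Lemma Rintegral_translate (R : realType) (a b c : R) (g : R -> R) :
  bounded_measurable (a + c) (b + c) g ->
  bounded_measurable a b (fun t => g (t + c)) /\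
  \int[mu]_(t in `[a, b]) g (t + c) = \int[mu]_(t in `[a + c, b + c]) g t.
Proof.
move=> bg.
have mphi : measurable_fun [set: R] (fun t : R => t + c).
  exact: measurable_funD.
have pre : (fun t : R => t + c) @^-1` `[a + c, b + c] = `[a, b]%classic.
  by apply/seteqP; split => t /=; rewrite !in_itv/= !lerD2r.
have [mg [M gM]] := bg.
have bgc : bounded_measurable a b (fun t => g (t + c)).
  split; last by exists M => t tab; rewrite gM// !lerD2r.
  apply: (@measurable_comp _ _ _ _ _ _ `[a + c, b + c]%classic) => //.
  - move=> _ [t + <-]; by rewrite /= !in_itv/= !lerD2r.
  - exact: measurable_funTS.
split=> //.
pose g' := g \_ `[a + c, b + c].
have mg' : measurable_fun [set: R] g' by exact/(measurable_restrictT _ _).1.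
have mphi' : @measurable_fun _ _ (measurableTypeR R) (measurableTypeR R)
    [set: R] (fun t : R => t + c) := mphi.
pose nu : {measure set (measurableTypeR R) -> \bar R} :=
  measure_function_pushforward__canonical__measure_function_Measure
    (@lebesgue_measure R) mphi'.
have nuE : forall A, measurable A -> @lebesgue_measure R A = nu A.
  apply: lebesgue_measure_unique => X [[x y] _ <-].
  rewrite /nu /= /pushforward.
  have -> : (fun t : R => t + c) @^-1` `]x, y] = `]x - c, y - c]%classic.
    by apply/seteqP; split => t /=; rewrite !in_itv/= ltrBlDr lerBrDr.
  rewrite /= !lebesgue_measure_itv/= !lte_fin ltrD2r; case: ifP => // _.
  by rewrite -!EFinB opprB addrA subrK.
have -> : \int[mu]_(t in `[a + c, b + c]) g t = \int[mu]_(t in `[a + c, b + c]) g' t.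
  apply: eq_Rintegral => t tab; rewrite /g' patchE tab//.
rewrite /Rintegral; congr fine.
transitivity (\int[nu]_(t in `[(a + c)%R, (b + c)%R]) (g' t)%:E)%E; last first.
  by apply: eq_measure_integral => A mA _; exact/esym/nuE.
rewrite [RHS](@integral_pushforward _ _ _ _ _ _ mphi'); last 3 first.
- exact/measurable_EFinP.
- rewrite pre; have := bounded_measurable_integrable bgc.
  apply: eq_integrable => // t; rewrite -pre inE /= => tab.
  by rewrite /g' patchE mem_set.
- by [].
rewrite pre; apply: eq_integral => t; rewrite -pre inE /= => tab.
by rewrite /g' patchE mem_set.
Qed.

(** The value at [c] comes from [g2], matching the convention of [cat_control]. Taking all three
    functions equal gives additivity over adjacent intervals. *)
Lemma Rintegral_glue (R : realType) (a b c : R) (g g1 g2 : R -> R) :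
  a <= c -> c <= b -> bounded_measurable a c g1 -> bounded_measurable c b g2 ->
  (forall t, a <= t < c -> g t = g1 t) -> (forall t, c <= t <= b -> g t = g2 t) ->
  bounded_measurable a b g /\
  \int[mu]_(t in `[a, b]) g t =
    \int[mu]_(t in `[a, c]) g1 t + \int[mu]_(t in `[c, b]) g2 t.
Proof.
move=> ac cb b1 b2 e1 e2.
have U : `[a, b]%classic = `[a, c[%classic `|` `[c, b]%classic.
  by rewrite -(@itv_bndbnd_setU _ _ (BLeft a) (BLeft c) (BRight b)) ?bnd_simp.
have bg : bounded_measurable a b g.
  have [m1 [M1 g1M]] := b1; have [m2 [M2 g2M]] := b2.
  split.
    rewrite U measurable_funU//; split.
      apply: (@eq_measurable_fun _ _ _ _ _ g1).
        by move=> t; rewrite inE /= in_itv /= => /e1.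
      by apply: measurable_funS m1 => //; apply: subset_itvl; rewrite bnd_simp.
    apply: (@eq_measurable_fun _ _ _ _ _ g2) m2.
    by move=> t; rewrite inE /= in_itv /= => /e2.
  exists (Num.max M1 M2) => t /andP[at_ tb]; rewrite le_max.
  have [tc|ct] := ltP t c.
    by rewrite e1 ?at_// g1M// at_ ltW.
  by rewrite e2 ?ct// g2M ?orbT// ct.
split=> //; rewrite U Rintegral_setU//=.
- congr (_ + _).
    rewrite -[RHS]Rintegral_itv_bndo_bndc.
      by apply: eq_Rintegral => t; rewrite inE /= in_itv /= => /e1.
    apply: integrableS (bounded_measurable_integrable b1) => //.
    by apply: subset_itvl; rewrite bnd_simp.
  by apply: eq_Rintegral => t; rewrite inE /= in_itv /= => /e2.
- by rewrite -U; exact: bounded_measurable_integrable.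
- apply/disj_set2P/seteqP; split => // t /= []; rewrite !in_itv /= => /andP[_ tc] /andP[ct _].
  by move: (lt_le_trans tc ct); rewrite ltxx.
Qed.

(** Gluing with the degenerate interval [[b, b]] discards the right endpoint, where concatenated
    controls may differ. *)
Lemma eq_Rintegral_itv (R : realType) (a b : R) (f g : R -> R) :
  bounded_measurable a b f -> (forall t, a <= t < b -> f t = g t) ->
  \int[mu]_(t in `[a, b]) f t = \int[mu]_(t in `[a, b]) g t.
Proof.
move=> bf fg; have [ab|ba] := leP a b; last first.
  by rewrite set_itv_ge ?bnd_simp -?ltNge// !Rintegral_set0.
have bgb : bounded_measurable b b g.
  split; last first.
    by exists `|g b| => t /andP[bt tb]; rewrite (le_anti (introT andP (conj bt tb))).
  rewrite set_itv1; exact: measurable_fun_set1.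
have [_ ->] := @Rintegral_glue R a b b g f g ab (lexx b) bf bgb
  (fun t h => esym (fg t h)) (fun t _ => erefl).
by rewrite set_itv1 Rintegral_set1 addr0.
Qed.

Lemma Rintegral_sum (R : realType) (a b : R) (I : Type) (r : seq I) (f : I -> R -> R) :
  (forall i, bounded_measurable a b (f i)) ->
  \int[mu]_(t in `[a, b]) (\sum_(i <- r) f i t) =
  \sum_(i <- r) \int[mu]_(t in `[a, b]) f i t.
Proof.
move=> bf; elim: r => [|i r IH].
  rewrite big_nil; under eq_Rintegral do rewrite big_nil.
  by rewrite Rintegral_cst// mul0r.
rewrite big_cons -IH -RintegralD//.
- by apply: eq_Rintegral => t _; rewrite big_cons.
- exact: bounded_measurable_integrable.
- exact/bounded_measurable_integrable/bounded_measurable_sum.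
Qed.

(** * Matrix-valued integrals and the variation of constants formula *)

Definition bounded_measurable_mx (R : realType) m n (a b : R) (G : R -> 'M[R]_(m, n)) :=
  forall i j, bounded_measurable a b (fun s => G s i j).

Definition Rintegral_mx (R : realType) m n (a b : R) (G : R -> 'M[R]_(m, n)) : 'M[R]_(m, n) :=
  \matrix_(i, j) \int[mu]_(s in `[a, b]) G s i j.

Lemma bounded_measurable_mxM (R : realType) m n p (a b : R)
    (F : R -> 'M[R]_(m, n)) (G : R -> 'M[R]_(n, p)) :
  bounded_measurable_mx a b F -> bounded_measurable_mx a b G ->
  bounded_measurable_mx a b (fun s => F s *m G s).
Proof.
move=> bF bG i j.
have -> : (fun s => (F s *m G s) i j) = (fun s => \sum_k F s i k * G s k j).
  by apply/funext => s; rewrite mxE.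
by apply: bounded_measurable_sum => k; exact: bounded_measurableM.
Qed.

Lemma bounded_measurable_mx_cst (R : realType) m n (a b : R) (M : 'M[R]_(m, n)) :
  bounded_measurable_mx a b (fun=> M).
Proof. by move=> i j; exact: bounded_measurable_cst. Qed.

Lemma Rintegral_mxM (R : realType) m n p (a b : R) (M : 'M[R]_(m, n))
    (G : R -> 'M[R]_(n, p)) : bounded_measurable_mx a b G ->
  M *m Rintegral_mx a b G = Rintegral_mx a b (fun s => M *m G s).
Proof.
move=> bG; apply/matrixP => i j; rewrite !mxE.
under [RHS]eq_Rintegral do rewrite mxE.
rewrite Rintegral_sum.
  apply: eq_bigr => k _; rewrite mxE RintegralZl//.
  exact: bounded_measurable_integrable.
move=> k; apply: bounded_measurableM => //; exact: bounded_measurable_cst.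
Qed.

Lemma Rintegral_mxMr (R : realType) m n p (a b : R) (M : 'M[R]_(n, p))
    (G : R -> 'M[R]_(m, n)) : bounded_measurable_mx a b G ->
  Rintegral_mx a b G *m M = Rintegral_mx a b (fun s => G s *m M).
Proof.
move=> bG; apply/matrixP => i j; rewrite !mxE.
under [RHS]eq_Rintegral do rewrite mxE.
rewrite Rintegral_sum.
  apply: eq_bigr => k _; rewrite mxE RintegralZr//.
  exact: bounded_measurable_integrable.
move=> k; apply: bounded_measurableM => //; exact: bounded_measurable_cst.
Qed.

Lemma Rintegral_mxD (R : realType) m n (a b : R) (F G : R -> 'M[R]_(m, n)) :
  bounded_measurable_mx a b F -> bounded_measurable_mx a b G ->
  Rintegral_mx a b (fun s => F s + G s) = Rintegral_mx a b F + Rintegral_mx a b G.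
Proof.
move=> bF bG; apply/matrixP => i j; rewrite !mxE -RintegralD//;
  try exact: bounded_measurable_integrable.
by apply: eq_Rintegral => s _; rewrite mxE.
Qed.

Lemma trajectoryE (R : realType) (d m : nat) (A : 'M[R]_d) (B : 'M[R]_(d, m)) t x w :
  trajectory A B t x w =
  expmx (t *: A) *m x + Rintegral_mx 0 t (fun s => expmx ((t - s) *: A) *m B *m w s).
Proof.
rewrite /trajectory; congr (_ + _); apply/matrixP => i j.
by rewrite !mxE (ord1 j).
Qed.

Lemma bounded_measurable_expmx (R : realType) d (A : 'M[R]_d) (a b t : R) :
  bounded_measurable_mx a b (fun s => expmx ((t - s) *: A)).
Proof.
move=> i j; apply: bounded_measurable_continuous => s.
apply: (@continuous_comp _ _ _ (fun s : R => t - s) (fun u => expmx (u *: A) i j)).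
  by apply: cvgB; [exact: cvg_cst|exact: cvg_id].
exact: expmx_coord_continuous.
Qed.

Lemma bounded_measurable_trajectory (R : realType) (d m : nat) (A : 'M[R]_d)
    (B : 'M[R]_(d, m)) (a b t : R) (w : R -> 'cV[R]_m) :
  bounded_measurable_mx a b w ->
  bounded_measurable_mx a b (fun s => expmx ((t - s) *: A) *m B *m w s).
Proof.
move=> bw; apply: bounded_measurable_mxM => //.
apply: bounded_measurable_mxM; first exact: bounded_measurable_expmx.
exact: bounded_measurable_mx_cst.
Qed.

Lemma trajectoryD (R : realType) (d m : nat) (A : 'M[R]_d) (B : 'M[R]_(d, m)) (t : R)
    x y (w v : R -> 'cV[R]_m) :
  bounded_measurable_mx 0 t w -> bounded_measurable_mx 0 t v ->
  trajectory A B t (x + y) (fun s => w s + v s) =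
  trajectory A B t x w + trajectory A B t y v.
Proof.
move=> bw bv; rewrite !trajectoryE mulmxDr addrACA -Rintegral_mxD.
- by congr (_ + Rintegral_mx _ _ _); apply/funext => s; rewrite mulmxDr.
- exact: bounded_measurable_trajectory.
- exact: bounded_measurable_trajectory.
Qed.

Lemma trajectory0 (R : realType) (d m : nat) (A : 'M[R]_d) (B : 'M[R]_(d, m)) x w :
  trajectory A B 0 x w = x.
Proof.
rewrite trajectoryE expmx0 mul1mx -[RHS]addr0; congr (_ + _).
by apply/matrixP => i j; rewrite !mxE set_itv1 Rintegral_set1.
Qed.

Lemma eq_trajectory (R : realType) (d m : nat) (A : 'M[R]_d) (B : 'M[R]_(d, m)) (t : R)
    x (w v : R -> 'cV[R]_m) :
  bounded_measurable_mx 0 t w -> (forall s, 0 <= s < t -> w s = v s) ->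
  trajectory A B t x w = trajectory A B t x v.
Proof.
move=> bw wv; rewrite !trajectoryE; congr (_ + _); apply/matrixP => i j; rewrite !mxE.
apply: eq_Rintegral_itv => [|s s0t]; last by rewrite wv.
exact: (bounded_measurable_trajectory A B t bw).
Qed.

Definition cat_control (R : realType) m (s : R) (w v : R -> 'cV[R]_m) (t : R) :=
  if t < s then w t else v (t - s).

(** The cocycle property: the convolution integral is cut at [s], and its second part is translated
    back to start at 0. *)
Lemma trajectory_cat (R : realType) (d m : nat) (A : 'M[R]_d) (B : 'M[R]_(d, m)) (s t : R)
    x (w v : R -> 'cV[R]_m) : 0 <= s -> 0 <= t ->
  bounded_measurable_mx 0 s w -> bounded_measurable_mx 0 t v ->
  trajectory A B (s + t) x (cat_control s w v) =
  trajectory A B t (trajectory A B s x w) v.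
Proof.
move=> s0 t0 bw bv; rewrite !trajectoryE mulmxDr mulmxA -expmxD (addrC t s) -addrA.
congr (_ + _); rewrite Rintegral_mxM; last exact: bounded_measurable_trajectory.
apply/matrixP => i j; rewrite !mxE.
have [|b2 i2] := @Rintegral_translate R s (s + t) (- s)
    (fun r => (expmx ((t - r) *: A) *m B *m v r) i j).
  rewrite subrr addrAC subrr add0r.
  exact: (bounded_measurable_trajectory A B t bv).
have [| | | | | |_ ->] := @Rintegral_glue R 0 (s + t) s
   (fun r => (expmx ((s + t - r) *: A) *m B *m cat_control s w v r) i j)
   (fun r => (expmx (t *: A) *m (expmx ((s - r) *: A) *m B *m w r)) i j)
   (fun r => (expmx ((t - (r - s)) *: A) *m B *m v (r - s)) i j).
- by [].
- by rewrite lerDl.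
- apply: bounded_measurable_mxM; first exact: bounded_measurable_mx_cst.
  exact: bounded_measurable_trajectory.
- exact: b2.
- move=> r /andP[r0 rs]; rewrite /cat_control rs.
  have -> : s + t - r = t + (s - r) by ring.
  by rewrite expmxD !mulmxA.
- move=> r /andP[sr rst]; rewrite /cat_control ltNge sr /=.
  by have -> : t - (r - s) = s + t - r by ring.
by rewrite i2 subrr (_ : s + t - s = t); last ring.
Qed.

Lemma cat_control_shift (R : realType) m (s : R) (w : R -> 'cV[R]_m) :
  cat_control s w (fun t => w (t + s)) = w.
Proof. by apply/funext => t; rewrite /cat_control subrK; case: ifP. Qed.

(** * Trajectories and control sets *)

Lemma controls_bounded_measurable (R : realType) m (U : set 'cV[R]_m) w a b :
  compact U -> controls U w -> bounded_measurable_mx a b w.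
Proof.
move=> /compact_bounded[M [_ UM]] [mw Uw] i j; split.
  by rewrite (ord1 j); apply: measurable_funTS.
exists (M + 1) => t _; apply: le_trans (le_mx_norm _ _ _) _.
by apply: (UM (M + 1)); [rewrite ltrDl|exact: Uw].
Qed.

Lemma controls_shift (R : realType) m (U : set 'cV[R]_m) w s :
  controls U w -> controls U (fun t => w (t + s)).
Proof.
move=> [mw Uw]; split => [i|t]; last exact: Uw.
apply: (measurableT_comp (mw i)); exact: measurable_funD.
Qed.

Lemma controls_cat (R : realType) m (U : set 'cV[R]_m) s w v :
  controls U w -> controls U v -> controls U (cat_control s w v).
Proof.
move=> cw cv; split => [i|t]; last first.
  by rewrite /cat_control; case: ifP => _; [exact: cw.2|exact: cv.2].
have -> : (fun t => cat_control s w v t i ord0) =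
    (fun t => if t < s then w t i ord0 else v (t - s) i ord0).
  by apply/funext => t; rewrite /cat_control; case: ifP.
apply: measurable_fun_ifT => //.
- exact: measurable_fun_ltr.
- exact: cw.1.
- exact: (controls_shift (- s) cv).1.
Qed.

Lemma mulmx_continuous (R : realType) m n p (M : 'M[R]_(m, n)) :
  continuous (fun x : 'M[R]_(n, p) => M *m x).
Proof.
move=> x; apply/(@cvgrPdist_le _ _ _ _ (nbhs_filter x)) => e e0.
pose c := n%:R * `|M| + 1.
have c0 : 0 < c by rewrite ltr_wpDl// mulr_ge0.
apply/nbhs_ballP; exists (e / c) => /=; first exact: divr_gt0.
move=> y; rewrite mx_norm_ball /ball_ /= => xy.
rewrite -mulmxBr (le_trans (mx_norm_mul _ _))//.
rewrite (@le_trans _ _ (c * `|x - y|))// ?ler_wpM2r ?lerDl//.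
by rewrite mulrC -ler_pdivlMr// ltW.
Qed.

Lemma trajectory_continuous (R : realType) (d m : nat) (A : 'M[R]_d) (B : 'M[R]_(d, m)) t w :
  continuous (fun x => trajectory A B t x w).
Proof.
move=> x; rewrite /trajectory; set c := \col_i _.
apply: (@cvgD _ _ _ _ (nbhs_filter x) (mulmx (expmx (t *: A))) (fun=> c)).
  exact: mulmx_continuous.
exact: (@cvg_cst _ _ _ _ (nbhs_filter x)).
Qed.

Local Opaque trajectory.

Section control_system_orbits.
Variables (R : realType) (d m : nat) (A : 'M[R]_d) (B : 'M[R]_(d, m)) (U : set 'cV[R]_m).
Hypothesis Uc : compact U.
Local Notation phi := (trajectory A B).
Local Notation orbit := (positive_orbit A B U).

Lemma trajectory_shift s t x w : 0 <= s -> 0 <= t -> controls U w ->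
  phi (s + t) x w = phi t (phi s x w) (fun r => w (r + s)).
Proof.
move=> s0 t0 cw; rewrite -{1}(cat_control_shift s w).
apply: trajectory_cat => //.
  exact: controls_bounded_measurable Uc cw.
exact: controls_bounded_measurable Uc (controls_shift s cw).
Qed.

Lemma trajectory_cat_left s t x w v : 0 <= t <= s -> controls U w ->
  phi t x (cat_control s w v) = phi t x w.
Proof.
move=> /andP[t0 ts] cw; apply/esym/eq_trajectory.
  exact: controls_bounded_measurable Uc cw.
by move=> r /andP[_ rt]; rewrite /cat_control (lt_le_trans rt ts).
Qed.

Lemma trajectory_cat_right s t x w v : 0 <= s -> 0 <= t -> controls U w -> controls U v ->
  phi (s + t) x (cat_control s w v) = phi t (phi s x w) v.
Proof.
move=> s0 t0 cw cv; apply: trajectory_cat => //.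
  exact: controls_bounded_measurable Uc cw.
exact: controls_bounded_measurable Uc cv. Qed.

Lemma positive_orbit_trans y x z : orbit x y -> orbit y z -> orbit x z.
Proof.
move=> [s [w [s0 cw <-]]] [t [v [t0 cv <-]]].
exists (s + t), (cat_control s w v); split; first exact: addr_gt0.
  exact: controls_cat.
by rewrite trajectory_cat_right// ltW.
Qed.

(** By continuity in the initial state, [w] carries orbit points near [y] to orbit points near
    [phi t y w]. *)
Lemma closure_positive_orbit_trajectory z y t w : 0 <= t -> controls U w ->
  closure (orbit z) y -> closure (orbit z) (phi t y w).
Proof.
rewrite le_eqVlt => /predU1P[<-|t0] cw; first by rewrite trajectory0.
move=> zy V /(@trajectory_continuous _ _ _ A B t w y) Vy.
have [x [zx Vx]] := zy _ Vy; exists (phi t x w); split => //.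
by apply: (positive_orbit_trans zx); exists t, w.
Qed.

(* Adjoining to a control set the piece of trajectory up to the return time
   yields a set with the same defining properties, so maximality applies. *)
Lemma control_set_no_return D x s t w : control_set A B U D -> controls U w ->
  0 <= s <= t -> D x -> D (phi t x w) -> D (phi s x w).
Proof.
move=> [inv app maxD] cw /andP[s0 st] Dx Dy.
pose D' := D `|` [set z | exists2 r, 0 <= r <= t & phi r x w = z].
suff <- : D' = D by right; exists s => //; rewrite s0.
apply: maxD; last by move=> z; left.
(* From a point of the adjoined piece, follow [w] for the remaining time [t - r], then a control
   that keeps the endpoint in [D]. *)
- move=> z [Dz|[r /andP[r0 rt] <-]].
    by have [v cv Dv] := inv _ Dz; exists v => // u u0; left; exact: Dv.
  have [v cv Dv] := inv _ Dy.
  exists (cat_control (t - r) (fun u => w (u + r)) v).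
    by apply: controls_cat => //; exact: controls_shift.
  move=> u u0; have [utr|tru] := leP u (t - r).
    right; exists (r + u); first by rewrite addr_ge0//= -lerBrDl.
    rewrite trajectory_cat_left ?u0//; last exact: controls_shift.
    by rewrite (trajectory_shift x r0 u0 cw).
  left; rewrite -(subrKC (t - r) u) trajectory_cat_right ?subr_ge0//.
  + rewrite -(trajectory_shift x r0 _ cw) ?subr_ge0// subrKC.
    by apply: Dv; rewrite subr_ge0 ltW.
  + exact: ltW.
  + exact: controls_shift.
have cl z : D z -> D' `<=` closure (orbit z).
  move=> Dz v [Dv|[r /andP[r0 rt] <-]]; first exact: app.
  by apply: closure_positive_orbit_trajectory => //; exact: app.
move=> z [Dz|[r /andP[r0 rt] <-]]; first exact: cl.
(* The endpoint [r = t] is separate because positive orbits require positive time. For [r < t] the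
   orbit of the endpoint, a point of [D], is contained in the orbit of [phi r x w]. *)
move: rt; rewrite le_eqVlt => /predU1P[->|rt]; first exact: cl.
apply: (subset_trans (cl _ Dy)); apply: closure_subset => v.
apply: positive_orbit_trans; exists (t - r), (fun u => w (u + r)); split.
- by rewrite subr_gt0.
- exact: controls_shift.
- by rewrite -(trajectory_shift x r0 _ cw) ?subrKC// subr_ge0 ltW.
Qed.

End control_system_orbits.

(** * Null controllability with small controls *)

Lemma is_derive_near_0 (R : realType) (F : R -> R) (t df : R) :
  is_derive t 1 F df -> (\near t, F t = 0) -> df = 0.
Proof.
move=> [_ <-] F0; rewrite (@near_eq_derive _ _ _ F (cst 0))//.
exact: derive_cst.
Qed.

Lemma near_itvoo (R : realType) (P : R -> Prop) (a b t : R) :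
  (forall s, a < s < b -> P s) -> a < t < b -> \near t, P t.
Proof.
move=> Pab tab.
have tab' : open_nbhs t `]a, b[%classic.
  by split; [exact: interval_open|rewrite /= in_itv].
by have := open_nbhs_nbhs tab'; apply: filterS => s; rewrite /= in_itv; exact: Pab.
Qed.

(** The integrals over [[0, x]] and [[x, T]] are nonnegative with sum 0, so the primitive vanishes
    identically, and so does its derivative [g]. *)
Lemma Rintegral_eq0_continuous (R : realType) (T : R) (g : R -> R) :
  continuous g -> (forall t, 0 <= g t) -> \int[mu]_(t in `[0, T]) g t = 0 ->
  forall s, 0 < s < T -> g s = 0.
Proof.
move=> cg g0 iT s sT; have /andP[s0 sT'] := sT.
have bg a b : bounded_measurable a b g by exact: bounded_measurable_continuous.
have F0 x : 0 < x < T -> \int[mu]_(t in `[0, x]) g t = 0.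
  move=> /andP[x0 xT].
  have [_] := @Rintegral_glue R 0 T x g g g (ltW x0) (ltW xT) (bg _ _) (bg _ _)
    (fun _ _ => erefl) (fun _ _ => erefl).
  rewrite iT => /esym/eqP; rewrite paddr_eq0; first by case/andP => /eqP.
  - exact: Rintegral_ge0.
  - exact: Rintegral_ge0.
have [dF <-] := continuous_FTC1_closed sT'
  (bounded_measurable_integrable (bg 0 T)) s0 (cg s).
rewrite derive1E.
apply: (@is_derive_near_0 _ (fun x => \int[mu]_(t in `[0, x]) g t) s).
  exact: derivableP.
exact: near_itvoo F0 sT.
Qed.

(** Repeated differentiation turns q e^(uA) B = 0 into q e^(uA) A^k B = 0 for all k. The rank
    condition gives q e^(uA) = 0, and the exponential is invertible. *)
Lemma controllable_annihilator (R : realType) (d m : nat) (A : 'M[R]_d)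
    (B : 'M[R]_(d, m)) (q : 'rV[R]_d) (a b : R) :
  controllable A B -> a < b ->
  (forall u, a < u < b -> q *m expmx (u *: A) *m B = 0) -> q = 0.
Proof.
move=> hAB ab qB.
have qAB k u : a < u < b -> q *m expmx (u *: A) *m (A ^+ k *m B) = 0.
  elim: k u => [|k IH] u uab; first by rewrite expr0 mul1mx qB.
  apply/rowP => j; rewrite [RHS]mxE.
  pose F s := (q *m expmx (s *: A) *m (A ^+ k *m B)) ord0 j.
  apply: (@is_derive_near_0 R F u).
    have := is_derive_mx_mulr (A ^+ k *m B)
      (is_derive_mx_mull q (is_derive_mx_expmx A u)) ord0 j.
    congr (is_derive _ _ _ (_ ord0 j)).
    by rewrite comm_expmx exprS -[(A * A ^+ k)%R]/(A *m A ^+ k) !mulmxA.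
  apply: near_itvoo uab => s sab.
  by rewrite /F IH// mxE.
pose u := (a + b) / 2.
have uab : a < u < b by rewrite /u; apply/andP; split; lra.
have : (q *m expmx (u *: A)) *m (\mxrow_(k < d) (A ^+ k *m B)) = 0.
  rewrite mul_mxrow -[RHS]mxrow0; apply: eq_mxrow => k.
  exact: qAB.
move/eqP; rewrite mulmx_free_eq0; last by rewrite /row_free hAB.
move=> /eqP qe; rewrite -(mulmx1 q) -(expmxN_mul A u) mulmxA qe mul0mx //.
Qed.

(** With the Gramian W, the integral of E E^T, the control E^T W^(-1) p steers 0 to [p]. Its size is
    linear in [|p|], so small errors need only small corrections. *)
Lemma null_control_bound (R : realType) (d m : nat) (A : 'M[R]_d)
    (B : 'M[R]_(d, m)) (T : R) : controllable A B -> 0 < T ->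
  exists2 c : R, 0 <= c & forall p : 'cV[R]_d, exists v : R -> 'cV[R]_m,
    [/\ forall i, measurable_fun [set: R] (fun t => v t i ord0),
        forall t, `|v t| <= c * `|p| & trajectory A B T 0 v = p].
Proof.
move=> hAB T0; pose E s := expmx ((T - s) *: A) *m B.
have cE i j : continuous (fun s => E s i j).
  move=> s; have -> : (fun s => E s i j) = (fun s => \sum_k expmx ((T - s) *: A) i k * B k j).
    by apply/funext => r; rewrite mxE.
  apply: cvg_sumr => k _; apply: cvgMr_tmp.
  apply: (@continuous_comp _ _ _ (fun s : R => T - s) (fun u => expmx (u *: A) i k)).
    by apply: cvgB; [exact: cvg_cst|exact: cvg_id].
  exact: expmx_coord_continuous.
have bE a b : bounded_measurable_mx a b E.
  by move=> i j; apply: bounded_measurable_continuous; exact: cE.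
have bEt a b : bounded_measurable_mx a b (fun s => (E s)^T).
  move=> i j; have := bE a b j i; congr (bounded_measurable _ _ _).
  by apply/funext => s; rewrite [RHS]mxE.
pose W := Rintegral_mx 0 T (fun s => E s *m (E s)^T).
have bW : bounded_measurable_mx 0 T (fun s => E s *m (E s)^T).
  exact: bounded_measurable_mxM.
have Wu : W \in unitmx.
  rewrite -row_free_unit -kermx_eq0; apply/eqP/row_matrixP => i; rewrite row0.
  have /sub_kermxP := row_sub i (kermx W).
  move: (row i _) => q qW.
  (* For q in the kernel of W the quadratic form q W q^T, which is the integral of |q E(s)|^2, is
     zero. *)
  have qWq : Rintegral_mx 0 T (fun s => q *m E s *m (q *m E s)^T) = 0.
    transitivity (q *m W *m q^T); last by rewrite qW mul0mx.
    rewrite Rintegral_mxM// Rintegral_mxMr; last first.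
      by apply: bounded_measurable_mxM => //; exact: bounded_measurable_mx_cst.
    by congr Rintegral_mx; apply/funext => s; rewrite trmx_mul !mulmxA.
  pose g s := \sum_k (q *m E s) ord0 k ^+ 2.
  have g0 s : 0 <= g s by rewrite sumr_ge0// => k _; exact: sqr_ge0.
  have cg : continuous g.
    move=> s; apply: cvg_sumr => k _.
    have h : (q *m E x) ord0 k @[x --> s] --> (q *m E s) ord0 k.
      rewrite [X in _ --> X]mxE.
      have -> : (fun x => (q *m E x) ord0 k) = (fun x => \sum_l q ord0 l * E x l k).
        by apply/funext => r; rewrite mxE.
      by apply: cvg_sumr => l _; apply: cvgMl_tmp; exact: cE.
    by under eq_fun do rewrite expr2; rewrite expr2; exact: cvgM.
  have ig : \int[mu]_(t in `[0, T]) g t = 0.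
    have := congr1 (fun M : 'M[R]_1 => M ord0 ord0) qWq.
    rewrite [RHS]mxE [LHS]mxE => qWq0; rewrite -[RHS]qWq0.
    apply: eq_Rintegral => s _; rewrite [RHS]mxE; apply: eq_bigr => k _.
    by rewrite [X in _ = _ * X]mxE expr2.
  have gz := Rintegral_eq0_continuous cg g0 ig.
  apply: (controllable_annihilator hAB T0) => u /andP[u0 uT].
  have : g (T - u) = 0 by apply: gz; rewrite subr_gt0 uT ltrBlDr ltrDl u0.
  rewrite /g /E opprB addrC subrK => /eqP.
  rewrite psumr_eq0; last by move=> k _; exact: sqr_ge0.
  move=> /allP qz; apply/rowP => k; rewrite [RHS]mxE.
  by have := qz k (mem_index_enum _); rewrite sqrf_eq0 mulmxA => /eqP.
have [c0 c00 Ec0] : exists2 c0 : R, 0 <= c0 & forall s, 0 <= s <= T -> `|(E s)^T| <= c0.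
  have /choice[M HM] : forall ij : 'I_m * 'I_d, exists M, forall s, 0 <= s <= T ->
      `|(E s)^T ij.1 ij.2| <= M.
    by move=> [i j]; have [_] := bEt 0 T i j.
  exists (\sum_ij `|M ij|); first by rewrite sumr_ge0.
  move=> s sT; apply: mx_norm_le; first by rewrite sumr_ge0.
  move=> i j; rewrite (le_trans (HM (i, j) s sT))//.
  by rewrite (le_trans (ler_norm _))// (bigD1 (i, j))//= lerDl sumr_ge0.
exists (d%:R * c0 * (d%:R * `|invmx W|)); first by rewrite !mulr_ge0.
move=> p; pose y := invmx W *m p.
(* Cutting off outside [[0, T]] makes the bound hold on the whole line, where controls are
   defined. *)
pose v s := if (0 <= s) && (s <= T) then (E s)^T *m y else 0.
exists v; split.
- move=> i; have [mE _] := bounded_measurable_mxM (bEt 0 T) (bounded_measurable_mx_cst 0 T y) i ord0.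
  have -> : (fun t => v t i ord0) = (fun t => ((E t)^T *m y) i ord0) \_ `[0, T].
    apply/funext => t; rewrite patchE /v mem_setE in_itv /=.
    by case: ifP => // _; rewrite mxE.
  exact/(measurable_restrictT _ _).1.
- move=> t; rewrite /v; case: ifP => tT; last first.
    by rewrite normr0 !mulr_ge0.
  rewrite (le_trans (mx_norm_mul _ _))// -[leRHS]mulrA.
  apply: ler_pM; rewrite ?mulr_ge0//.
    by rewrite ler_wpM2l// Ec0.
  exact: mx_norm_mul.
- rewrite trajectoryE mulmx0 add0r.
  transitivity (Rintegral_mx 0 T (fun s => E s *m (E s)^T *m y)).
    apply/matrixP => i j; rewrite !mxE; apply: eq_Rintegral => s.
    by rewrite inE/= in_itv/= /v => ->; rewrite mulmxA.
  by rewrite -Rintegral_mxMr// -/W /y mulmxA mulmxV// mul1mx.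
Qed.

(** * Measurability of running costs, margins around controls, and steering *)

Lemma open_preimage_measurable (R : realType) m (w : R -> 'cV[R]_m) (V : set 'cV[R]_m) :
  (forall i, measurable_fun [set: R] (fun t => w t i ord0)) -> open V ->
  measurable (w @^-1` V).
Proof.
move=> mw oV.
pose q (c : 'cV[rat]_m * nat) : 'cV[R]_m := map_mx (@ratr R) c.1.
pose r (c : 'cV[rat]_m * nat) : R := c.2.+1%:R^-1.
(* [V] is exhausted by countably many balls with rational centre and radius 1/(n+1) contained in it.
   The half radius in each entry turns the non-strict norm bound into a strict one. *)
pose box (c : 'cV[rat]_m * nat) : set R :=
  if `[< forall u, `|u - q c| < r c -> V u >] then
    [set t | forall i, `|w t i ord0 - q c i ord0| < r c / 2] else set0.
have -> : w @^-1` V = \bigcup_c box c.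
  apply/seteqP; split => [t /= Vt|t [c _]]; last first.
    rewrite /box; case: asboolP => // cV /= wt; apply: cV.
    have r0 : 0 < r c by rewrite invr_gt0.
    apply: (@le_lt_trans _ _ (r c / 2)); last by rewrite ltr_pdivrMr// ltr_pMr// ltr1n.
    apply: mx_norm_le => [|i j]; first by rewrite divr_ge0// ltW.
    by rewrite !mxE (ord1 j); have := wt i; rewrite mxE => /ltW.
  have : nbhs (w t) V by exact: open_nbhs_nbhs.
  rewrite -nbhs_ballE => -[e /= e0]; rewrite mx_norm_ball /ball_ /= => eV.
  have [n ne] : exists n, n.+1%:R^-1 < e / 2.
    pose n := Num.truncn (2 / e); exists n.
    rewrite -[e / 2]invrK ltf_pV2 ?posrE ?invr_gt0 ?divr_gt0// invf_div.
    by have /andP[] := truncn_itv (divr_ge0 (ler0n R 2) (ltW e0)).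
  have rn0 : 0 < n.+1%:R^-1 / 2 :> R by rewrite divr_gt0.
  have /choice[p Hp] : forall i, exists p : rat, `|w t i ord0 - ratr p| < n.+1%:R^-1 / 2.
    move=> i; have [p] := rat_in_itvoo (ltr_pwDr rn0 (lexx (w t i ord0))).
    rewrite in_itv/= => /andP[p1 p2]; exists p.
    by rewrite ltr_norml ltrNl opprB ltrBlDl p2/= (lt_trans _ rn0)// subr_lt0.
  exists (\col_i p i, n) => //; rewrite /box; case: asboolP => [_ i|].
    by rewrite /q !mxE; exact: Hp.
  case=> u uq; apply: eV; rewrite /= -(subrKA (q (\col_i p i, n))).
  apply: le_lt_trans (ler_normD _ _) _; rewrite [e]splitr; apply: ltrD.
    apply: le_lt_trans ne; apply: mx_norm_le => // i j.
    rewrite !mxE (ord1 j) ltW// (lt_trans (Hp i))// ltr_pdivrMr// ltr_pMr// ltr1n//.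
  by rewrite distrC; apply: lt_trans uq ne.
apply: countable_bigcupT_measurable => // c; rewrite /box; case: asboolP => // _.
have -> : [set t | forall i, `|w t i ord0 - q c i ord0| < r c / 2] =
    \bigcap_(i in [set: 'I_m]) [set t | `|w t i ord0 - q c i ord0| < r c / 2].
  by apply/seteqP; split => t /= H i; [move=> _|]; apply: H.
apply: fin_bigcap_measurable => // i _.
have mg : measurable_fun [set: R] (fun t => `|w t i ord0 - q c i ord0|).
  by apply: measurableT_comp => //; exact: measurable_funB.
have := mg measurableT `]-oo, (r c / 2)[%classic (measurable_itv _); rewrite setTI.
by congr measurable; apply/seteqP; split => t; rewrite /= in_itv /=.
Qed.

(** [f] is continuous only on [U], so the preimage of an open interval is the trace on [U] of an
    open [V]; as [w] stays in [U], the preimage under [f \o w] is that of [V] under [w]. *)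
Lemma measurable_fun_control (R : realType) m (U : set 'cV[R]_m) (f : 'cV[R]_m -> R) w :
  {within U, continuous f} -> controls U w -> measurable_fun [set: R] (f \o w).
Proof.
move=> /continuousP cf [mw Uw].
apply: (measurability _ (RGenOpens.measurableE R)).
move=> _ [_ [a [b ->] <-]]; rewrite setTI.
have [V oV VU] := (open_subspaceP _ _).1 (cf _ (@interval_open _ (BRight a) (BLeft b) isT isT)).
rewrite (_ : _ @^-1` _ = w @^-1` V); first exact: open_preimage_measurable.
apply/seteqP; split => t /= h.
  have [//] : (V `&` U) (w t) by rewrite VU; split => //; exact: Uw.
by have : (V `&` U) (w t); [split => //; exact: Uw|rewrite VU => -[]].
Qed.

Lemma compact_continuous_bounded (R : realType) m (U : set 'cV[R]_m) (f : 'cV[R]_m -> R) :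
  compact U -> {within U, continuous f} -> exists2 M, 0 <= M & forall u, U u -> `|f u| <= M.
Proof.
move=> cU cf; have [M [_ HM]] := compact_bounded (continuous_compact cf cU).
exists (`|M| + 1) => [|u Uu]; first by rewrite addr_ge0.
by apply: (HM (`|M| + 1)); [rewrite ltr_pwDr// ler_norm|exists u].
Qed.

Lemma bounded_measurable_control (R : realType) m (U : set 'cV[R]_m) (f : 'cV[R]_m -> R) w a b :
  compact U -> {within U, continuous f} -> controls U w ->
  bounded_measurable a b (fun t => f (w t)).
Proof.
move=> cU cf cw; split.
  by apply: measurable_funTS; exact: measurable_fun_control cf cw.
have [M _ HM] := compact_continuous_bounded cU cf.
by exists M => t _; apply: HM; exact: cw.2.
Qed.

(** Near each point of [C] half of a good radius serves all neighbours, and compactness makes the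
    radius uniform. It is the tolerance within which [w0] may be perturbed, both for staying in [U]
    and for the cost. *)
Lemma compact_margin (R : realType) m (U C : set 'cV[R]_m) (f : 'cV[R]_m -> R) (e : R) :
  compact C -> C `<=` interior U -> {within U, continuous f} -> 0 < e ->
  exists2 r : R, 0 < r & forall c u, C c -> `|u - c| <= r -> U u /\ `|f u - f c| <= e.
Proof.
move=> cC CU cf e0.
have cfU x : interior U x -> {for x, continuous f}.
  have := continuous_subspaceW (@interior_subset _ U) cf.
  rewrite continuous_open_subspace; last exact: open_interior.
  by move=> cUf Ux; exact/cUf/mem_set.
pose P r c := forall u, `|u - c| <= r -> U u /\ `|f u - f c| <= e.
suff : \forall r \near (0 : R)^'+, C `<=` P r.
  move=> near_r; have [r [r0 Pr]] := filter_ex (filterI (nbhs_right_gt (0 : R)) near_r).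
  by exists r => // c u Cc; exact: Pr.
apply: ((compact_near_coveringP C).1 cC) => x Cx.
have xU := CU _ Cx.
have e20 : 0 < e / 2 by rewrite divr_gt0.
have : \forall y \near x, U y /\ `|f x - f y| <= e / 2.
  apply: filterI => //.
  have := cfU x xU => /(@cvgrPdist_le _ _ _ _ (nbhs_filter x)); exact.
move=> /nbhs_ballP[r /= r0]; rewrite mx_norm_ball /ball_ /= => Hr.
have r20 : 0 < r / 2 by rewrite divr_gt0.
exists (ball x (r / 2), [set s : R | 0 < s < r / 2]); first split => /=.
- exact: nbhsx_ballx.
- apply: filterS2 (nbhs_right_gt (0 : R)) (nbhs_right_lt r20) => s s0 sr.
  by rewrite /= s0.
- move=> [c s] /= [xc /andP[s0 sr]] u uc.
  move: xc; rewrite mx_norm_ball /ball_ /= => xc.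
  have [Uc fc] : U c /\ `|f x - f c| <= e / 2.
    by apply: Hr => /=; rewrite (lt_trans xc)// ltr_pdivrMr// ltr_pMr// ltr1n.
  have [Uu fu] : U u /\ `|f x - f u| <= e / 2.
    apply: Hr => /=; rewrite -(subrKA c) (le_lt_trans (ler_normD _ _))//.
    by rewrite [r]splitr ltrD// distrC (le_lt_trans uc).
  split => //; rewrite -(subrKA (f x)) (le_trans (ler_normD _ _))//.
  by rewrite [e]splitr lerD// distrC.
Qed.

Lemma control_set_steering (R : realType) (d m : nat) (A : 'M[R]_d) (B : 'M[R]_(d, m))
    (U : set 'cV[R]_m) (D K V : set 'cV[R]_d) y :
  control_set A B U D -> compact K -> K `<=` D -> D y -> nbhs y V ->
  exists L : seq (R * (R -> 'cV[R]_m)),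
    (forall p, p \in L -> 0 < p.1 /\ controls U p.2) /\
    (forall x, K x -> exists2 p, p \in L & V (trajectory A B p.1 x p.2)).
Proof.
move=> [_ app _] cK KD Dy; rewrite nbhsE => -[V' [oV' yV'] V'V].
pose I := [set p : R * (R -> 'cV[R]_m) | 0 < p.1 /\ controls U p.2].
pose g (p : R * (R -> 'cV[R]_m)) := (fun x => trajectory A B p.1 x p.2) @^-1` V'.
move: cK; rewrite compact_cover => /(_ _ I g)[].
- move=> p _; apply: open_comp oV' => x _; exact: trajectory_continuous.
- move=> x Kx.
  have [z [[t [w [t0 cw <-]]] V'z]] := app _ (KD _ Kx) _ Dy _ (open_nbhs_nbhs (conj oV' yV')).
  by exists (t, w).
- move=> L LI KL; exists (finmap.enum_fset L); split => [p pL|x Kx].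
    by have := LI _ pL; rewrite inE.
  have [p pL gp] := KL _ Kx; exists p => //; exact: V'V.
Qed.

(** * Returning to a neighborhood of a periodic point *)

(* A perturbation [x0 + r Q z] of the fixed point is sent by the time-[T] map to
   [x0 + r Q (P e^{TA} Q z)]; a control correcting only the finitely many errors
   [- r Q p], with [p] in the covering, brings it back into the same neighborhood. *)
Lemma local_return (R : realType) (d m : nat) (A : 'M[R]_d) (B : 'M[R]_(d, m))
    (T : R) (x0 : 'cV[R]_d) (w0 : R -> 'cV[R]_m) (V : set 'cV[R]_d) (delta : R)
    (P Q : 'M[R]_d) (F : seq 'cV[R]_d) :
  controllable A B -> 0 < T -> bounded_measurable_mx 0 T w0 ->
  (forall i, measurable_fun [set: R] (fun t => w0 t i ord0)) ->
  trajectory A B T x0 w0 = x0 -> nbhs x0 V -> 0 < delta ->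
  P *m Q = 1%:M -> covers (P *m expmx (T *: A) *m Q) 1 F ->
  exists2 V' : set 'cV[R]_d, nbhs x0 V' /\ V' `<=` V &
  exists S : seq (R -> 'cV[R]_m), [/\ size S = size F,
    forall w, w \in S -> (forall i, measurable_fun [set: R] (fun t => w t i ord0)) /\
                       (forall t, `|w t - w0 t| <= delta) &
    forall x, V' x -> exists2 w, w \in S & V' (trajectory A B T x w)].
Proof.
move=> hAB T0 bw0 mw0 x0E x0V delta0 PQ cF.
have [c c0 Hc] := null_control_bound hAB T0.
have [r0 r00 Vr0] : exists2 r0 : R, 0 < r0 & forall y, `|x0 - y| < r0 -> V y.
  move: x0V => /nbhs_ballP[r0 /= r00]; rewrite mx_norm_ball /ball_ /= => Hr.
  by exists r0 => // y; exact: Hr.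
pose k := c * (\sum_(p <- F) `|Q *m p|) + 1.
have k0 : 0 < k by rewrite ltr_wpDl// mulr_ge0// sumr_ge0.
pose l := d%:R * `|Q| + 1.
have l0 : 0 < l by rewrite ltr_wpDl// mulr_ge0.
(* The first bound keeps every correction below [delta], the sum in [k] dominating each term; the
   second keeps [V'] within [r0 / 2] of [x0]. *)
pose r := Num.min (delta / k) (r0 / 2 / l).
have rpos : 0 < r by rewrite lt_min !divr_gt0.
pose V' := [set x | exists2 z : 'cV[R]_d, `|z| <= 1 & x = x0 + r *: (Q *m z)].
have VV : V' `<=` V.
  move=> _ [z z1 ->]; apply: Vr0; rewrite opprD addNKr normrN normrZ gtr0_norm//.
  apply: (@le_lt_trans _ _ (r0 / 2)); last by rewrite ltr_pdivrMr// ltr_pMr// ltr1n.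
  have rl : r * l <= r0 / 2 by rewrite -ler_pdivlMr// ge_min lexx orbT.
  apply: le_trans rl; rewrite ler_pM2l// (le_trans (mx_norm_mul _ _))//.
  by rewrite (le_trans (ler_wpM2l _ z1)) ?mulr1 ?lerDl// mulr_ge0.
have x0V' : nbhs x0 V'.
  pose h := d%:R * `|P| + 1.
  have h0 : 0 < h by rewrite ltr_wpDl// mulr_ge0.
  apply/nbhs_ballP; exists (r / h); first exact: divr_gt0.
  move=> y; rewrite mx_norm_ball /ball_ /= distrC => yx.
  exists (r^-1 *: (P *m (y - x0))); last first.
    rewrite -scalemxAr scalerA mulfV ?gt_eqF// scale1r mulmxA (mulmx1C PQ) mul1mx.
    by rewrite addrC subrK.
  rewrite normrZ gtr0_norm ?invr_gt0// ler_pdivrMl// mulr1.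
  rewrite (le_trans (mx_norm_mul _ _))// (@le_trans _ _ (h * `|y - x0|))//.
    by rewrite ler_wpM2r// lerDl.
  by rewrite mulrC -ler_pdivlMr// ltW.
have /choice[v Hv] := Hc.
exists V' => //.
exists [seq (fun t => w0 t + v (- (r *: (Q *m p))) t) | p <- F]; split.
- by rewrite size_map.
- move=> _ /mapP[p pF ->]; have [mv vc _] := Hv (- (r *: (Q *m p))); split => [i|t].
    have := measurable_funD (mw0 i) (mv i); congr (measurable_fun _ _).
    by apply/funext => t; rewrite /= mxE.
  rewrite /= addrC addKr (le_trans (vc _))// normrN normrZ gtr0_norm//.
  have rk : r * k <= delta by rewrite -ler_pdivlMr// ge_min lexx.
  apply: le_trans rk; rewrite mulrCA ler_pM2l// /k.
  rewrite (@le_trans _ _ (c * \sum_(p <- F) `|Q *m p|)) ?lerDl// ler_wpM2l//.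
  by rewrite (big_rem p)//= lerDl sumr_ge0.
- move=> _ [z z1 ->]; have [p pF pr] := cF z z1.
  exists (fun t => w0 t + v (- (r *: (Q *m p))) t); first by apply/mapP; exists p.
  have [mv vc vp] := Hv (- (r *: (Q *m p))).
  have bv : bounded_measurable_mx 0 T (v (- (r *: (Q *m p)))).
    move=> i j; split; first by rewrite (ord1 j); apply: measurable_funTS.
    by eexists => t _; apply: le_trans (le_mx_norm _ _ _) (vc t).
  (* By superposition the new state is again in cube coordinates, with [z] replaced by
     [P e^(TA) Q z - p], of norm at most 1 by the covering. *)
  rewrite trajectoryD// x0E; exists (P *m expmx (T *: A) *m Q *m z - p) => //.
  congr (_ + _).
  have -> : trajectory A B T (r *: (Q *m z)) (v (- (r *: (Q *m p)))) =
      expmx (T *: A) *m (r *: (Q *m z)) + trajectory A B T 0 (v (- (r *: (Q *m p)))).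
    by rewrite !trajectoryE mulmx0 add0r.
  rewrite vp -scalemxAr -scalerBr; congr (_ *: _).
  by rewrite mulmxBr !mulmxA (mulmx1C PQ) mul1mx.
Qed.

(** The controls are the words of length [j] over [S]. The pointwise comparison with [w0] survives
    concatenation because [w0] is back at the same phase after time [T]. *)
Lemma iterate_return (R : realType) (d m : nat) (A : 'M[R]_d) (B : 'M[R]_(d, m))
    (U : set 'cV[R]_m) (T : R) (w0 : R -> 'cV[R]_m) (V : set 'cV[R]_d)
    (f : 'cV[R]_m -> R) (e : R) (S : seq (R -> 'cV[R]_m)) :
  compact U -> 0 < T -> 0 <= e -> controls U w0 -> (forall t, w0 (t + T) = w0 t) ->
  (forall w, w \in S -> controls U w /\ forall t, f (w t) <= f (w0 t) + e) ->
  (forall x, V x -> exists2 w, w \in S & V (trajectory A B T x w)) ->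
  forall j, exists Sj : seq (R -> 'cV[R]_m), [/\ size Sj = (size S ^ j)%N,
    forall w, w \in Sj -> controls U w /\ forall t, f (w t) <= f (w0 t) + e &
    forall x, V x -> exists2 w, w \in Sj & V (trajectory A B (j%:R * T) x w)].
Proof.
move=> cU T0 e0 cw0 w0T HS VS; elim=> [|j [Sj [sSj HSj VSj]]].
  exists [:: w0]; split; first by rewrite expn0.
    move=> w; rewrite inE => /eqP ->; split; first exact: cw0.
    by move=> t; rewrite lerDl.
  move=> x Vx; exists w0; first exact: mem_head.
  by rewrite mul0r trajectory0.
exists [seq cat_control T w v | w <- S, v <- Sj]; split.
- by rewrite size_allpairs sSj expnS.
- move=> _ /allpairsP[[w v] /= [wS vSj ->]].
  have [cw fw] := HS _ wS; have [cv fv] := HSj _ vSj; split; first exact: controls_cat.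
  move=> t; rewrite /cat_control; case: ifP => // _.
  by rewrite -[in leRHS](subrK T t) w0T.
- move=> x Vx; have [w wS Vw] := VS _ Vx; have [v vSj Vv] := VSj _ Vw.
  exists (cat_control T w v); first by apply/allpairsP; exists (w, v).
  rewrite -natr1 mulrDl mul1r addrC (trajectory_cat_right A B cU)//.
  + exact: ltW.
  + by rewrite mulr_ge0// ltW.
  + by have [] := HS _ wS.
  + by have [] := HSj _ vSj.
Qed.

(** Full periods contribute exactly their share of the mean. One [M * T] bounds the integral over
    the incomplete period, the other its share of the mean. *)
Lemma Rintegral_periodic_le (R : realType) (T M : R) (g : R -> R) :
  0 < T -> (forall t, g (t + T) = g t) -> (forall a b, bounded_measurable a b g) ->
  (forall t, `|g t| <= M) -> forall s, 0 <= s ->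
  \int[mu]_(t in `[0, s]) g t <=
    s * (T^-1 * \int[mu]_(t in `[0, T]) g t) + (M * T + M * T).
Proof.
move=> T0 gT bg gM.
have M0 : 0 <= M by exact: le_trans (gM 0).
have int_le s : 0 <= s -> `|\int[mu]_(t in `[0, s]) g t| <= M * s.
  move=> s0; have := le_normr_Rintegral _ (bounded_measurable_integrable (bg 0 s)).
  move=> /(_ (measurable_itv _)) /le_trans; apply.
  have -> : M * s = \int[mu]_(t in `[0, s]) M.
    by rewrite Rintegral_cst// fine_lebesgue_measure_itv.
  apply: le_Rintegral => //.
  - apply: bounded_measurable_integrable; split; last first.
      by exists M => t _; rewrite normr_id.
    by apply: measurableT_comp => //; have [] := bg 0 s.
  - exact/bounded_measurable_integrable/bounded_measurable_cst.
set I := \int[mu]_(t in `[0, T]) g t.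
move=> s s0.
have [k sk] : exists k : nat, s < k%:R * T.
  exists (Num.truncn (s / T)).+1; rewrite -ltr_pdivrMr//.
  by have /andP[] := truncn_itv (divr_ge0 s0 (ltW T0)).
elim: k s s0 sk => [|k IH] s s0 sk.
  by move: sk; rewrite mul0r ltNge s0.
have [sT|Ts] := ltP s T.
  have h1 : \int[mu]_(t in `[0, s]) g t <= M * T.
    by rewrite (le_trans (ler_norm _))// (le_trans (int_le _ s0))// ler_wpM2l// ltW.
  have h2 : - (M * T) <= s * (T^-1 * I).
    rewrite lerNl -mulrN -mulrN.
    have -> : s * (T^-1 * - I) = (s / T) * (- I) by rewrite mulrA.
    have sT1 : s / T <= 1 by rewrite ler_pdivrMr// mul1r ltW.
    apply: (@le_trans _ _ (s / T * (M * T))).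
      apply: ler_wpM2l; first by rewrite divr_ge0// ltW.
      by rewrite (le_trans (ler_norm _))// normrN int_le// ltW.
    by rewrite ler_piMl// mulr_ge0// ltW.
  lra.
have [_ ->] := @Rintegral_glue R 0 s T g g g (ltW T0) Ts (bg _ _) (bg _ _)
    (fun _ _ => erefl) (fun _ _ => erefl).
have [_] := @Rintegral_translate R 0 (s - T) T g (bg _ _).
rewrite add0r subrK => <-.
have -> : \int[mu]_(t in `[0, s - T]) g (t + T) = \int[mu]_(t in `[0, s - T]) g t.
  by apply: eq_Rintegral => t _; rewrite gT.
have := IH (s - T); rewrite subr_ge0 Ts ltrBlDr => /(_ isT).
rewrite -natr1 mulrDl mul1r in sk; move=> /(_ sk) h.
rewrite -/I; have -> : s * (T^-1 * I) = I + (s - T) * (T^-1 * I).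
  by field; rewrite gt_eqF.
lra.
Qed.

(** * The pressure estimate *)

Lemma periodic_mul (R : realType) (X : Type) (w : R -> X) (T : R) (n : nat) :
  (forall t, w (t + T) = w t) -> forall t, w (t + n%:R * T) = w t.
Proof.
move=> wT; elim: n => [|n IH] t; first by rewrite mul0r addr0.
by rewrite -natr1 mulrDl mul1r addrA wT.
Qed.

(** Perturbed controls must take values in [U] at all real times, negative ones included, so the
    margin has to hold beyond one period. *)
Lemma periodic_range (R : realType) (X : Type) (w : R -> X) (T : R) (C : set X) :
  0 < T -> (forall t, w (t + T) = w t) -> w @` `[0, T] `<=` C -> forall t, C (w t).
Proof.
move=> T0 wT wC t.
pose n := (Num.truncn (`|t| / T)).+1; pose u := t + n%:R * T.
have u0 : 0 <= u.
  have : `|t| < n%:R * T.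
    rewrite -ltr_pdivrMr//.
    have /andP[_ h] := truncn_itv (divr_ge0 (normr_ge0 t) (ltW T0)).
    exact: h.
  by move=> h; rewrite /u -lerBlDr sub0r lerNl (le_trans (ler_norm _))// normrN ltW.
pose k := Num.truncn (u / T).
have /andP[k1 k2] := truncn_itv (divr_ge0 u0 (ltW T0)).
rewrite ler_pdivlMr// in k1; rewrite ltr_pdivrMr// in k2.
have -> : w t = w (u - k%:R * T).
  transitivity (w u); first by rewrite /u (periodic_mul n wT).
  by rewrite -{1}(subrK (k%:R * T) u) (periodic_mul k wT).
apply: wC; exists (u - k%:R * T) => //=.
rewrite in_itv /= subr_ge0 k1 /= lerBlDr.
by move: k2; rewrite -natr1 mulrDl mul1r addrC => /ltW.
Qed.

Lemma esum_seq_le (R : realType) (I : choiceType) (s : seq I) (g : I -> R) (M : R) :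
  (forall i, i \in s -> 0 <= g i <= M) -> 0 <= M ->
  (\esum_(i in [set` s]) (g i)%:E <= ((size s)%:R * M)%:E)%E.
Proof.
move=> gM M0; have -> : [set` s] = [set` undup s].
  by apply/seteqP; split => i /=; rewrite mem_undup.
rewrite esum_fset; last 2 first.
- exact: finite_seq.
- by move=> i; rewrite inE /= mem_undup => /gM/andP[]; rewrite lee_fin.
rewrite -fsbig_seq ?undup_uniq// sumEFin lee_fin.
apply: (@le_trans _ _ (\sum_(i <- undup s) M)).
  rewrite big_seq [leRHS]big_seq; apply: ler_sum => i.
  by rewrite mem_undup => /gM/andP[].
rewrite big_const_seq count_predT iter_addr_0 -[leLHS]mulr_natl ler_wpM2r// ler_nat.
exact: size_undup.
Qed.

(** The steering phase costs at most the supremum of |f| per unit time; afterwards [v] starts at its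
    own time 0 and is compared with [w0] from there. *)
Lemma action_cat_le (R : realType) m (U : set 'cV[R]_m) (f : 'cV[R]_m -> R)
    (M e t1 tau : R) (w1 w0 v : R -> 'cV[R]_m) :
  compact U -> {within U, continuous f} -> (forall u, U u -> `|f u| <= M) ->
  controls U w1 -> controls U w0 -> controls U v ->
  (forall t, f (v t) <= f (w0 t) + e) -> 0 <= t1 <= tau ->
  action tau f (cat_control t1 w1 v) <=
    M * t1 + (\int[mu]_(t in `[0, tau - t1]) f (w0 t) + e * (tau - t1)).
Proof.
move=> cU cf fM cw1 cw0 cv fv /andP[t10 t1tau].
have bf w a b : controls U w -> bounded_measurable a b (fun t => f (w t)).
  exact: bounded_measurable_control.
rewrite /action.
have [bs ist] := @Rintegral_translate R t1 tau (- t1) (fun t => f (v t)) (bf _ _ _ cv).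
have [| |_ ->] := @Rintegral_glue R 0 tau t1 (fun t => f (cat_control t1 w1 v t))
  (fun t => f (w1 t)) (fun t => f (v (t - t1))) t10 t1tau (bf _ _ _ cw1) bs.
- by move=> t /andP[_ h]; rewrite /cat_control h.
- by move=> t /andP[h _]; rewrite /cat_control ltNge h.
apply: lerD.
  apply: (@le_trans _ _ (\int[mu]_(t in `[0, t1]) M)); last first.
    by rewrite Rintegral_cst// fine_lebesgue_measure_itv.
  apply: le_Rintegral => //.
  - exact: bounded_measurable_integrable (bf _ _ _ cw1).
  - exact: bounded_measurable_integrable (bounded_measurable_cst _ _ _).
  - by move=> t _; apply: le_trans (ler_norm _) (fM _ (cw1.2 t)).
rewrite ist subrr.
apply: (@le_trans _ _ (\int[mu]_(t in `[0, tau - t1]) (f (w0 t) + e))).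
  apply: le_Rintegral => //.
  - exact: bounded_measurable_integrable (bf _ _ _ cv).
  - apply: bounded_measurable_integrable.
    exact: bounded_measurableD (bf _ _ _ cw0) (bounded_measurable_cst _ _ _).
rewrite RintegralD//.
- by rewrite Rintegral_cst// fine_lebesgue_measure_itv// subr_ge0.
- exact: bounded_measurable_integrable (bf _ _ _ cw0).
- exact: bounded_measurable_integrable (bounded_measurable_cst _ _ _).
Qed.

Lemma limf_esup_pinfty_le (R : realType) (g : R -> \bar R) (x : \bar R) (t0 : R) :
  (forall t, t0 <= t -> (g t <= x)%E) -> (limf_esup g +oo%R <= x)%E.
Proof.
move=> gx; apply: (@le_trans _ _ (ereal_sup (g @` [set t | t0 <= t]))).
  apply: ereal_inf_lbound; exists [set t | t0 <= t] => //.
  exact: (nbhs_pinfty_ge (num_real t0)).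
by apply: ge_ereal_sup => _ [t t0t <-]; exact: gx.
Qed.

Lemma a_inf_ge0 (R : realType) (d m : nat) (A : 'M[R]_d) (B : 'M[R]_(d, m)) U tau f K Q :
  (0 <= a_inf A B U tau f K Q)%E.
Proof.
apply: le_ereal_inf_tmp => _ [S _ <-].
by apply: esum_ge0 => w _; rewrite lee_fin expR_ge0.
Qed.

Lemma lne_le (R : realType) (x : \bar R) (y : R) :
  (0 <= x)%E -> (x <= (expR y)%:E)%E -> (lne x <= y%:E)%E.
Proof.
move=> x0 xy; rewrite -[y]expRK -lne_EFin ?expR_gt0//.
by rewrite lee_lne// in_itv /= ?x0 ?leey// lee_fin expR_ge0.
Qed.

Lemma P_inv_le_periodic (R : realType) (d m : nat)
    (A : 'M[R]_d) (B : 'M[R]_(d, m)) (U : set 'cV[R]_m) (D K : set 'cV[R]_d)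
    (f : 'cV[R]_m -> R) (h : R) (a : \bar R) :
  controllable A B -> compact U -> control_set A B U D -> {within U, continuous f} ->
  compact K -> K `<=` D -> flow_covering A h -> 0 <= h ->
  periodic_averages A B U D f a -> (P_inv A B U f K D <= h%:E + a)%E.
Proof.
move=> hAB cU hD cf cK KD covA h0.
move=> [T [w0 [x0 [T0 [cw0 w0T] xT [C [cC CU wC]] ->]]]].
set avg := T^-1 * action T f w0; rewrite -EFinD.
have w0C := periodic_range T0 w0T wC.
apply/lee_addgt0Pr => e3 e30; rewrite -EFinD.
(* Three losses of rate [e]: the covering constant, the change of cost under perturbation, and the
   terms bounded in [tau]. *)
pose e := e3 / 3; have e0 : 0 < e by rewrite divr_gt0.
have [M M0 fM] := compact_continuous_bounded cU cf.
have [C1 C10 HC1] := covA 1 ltr01.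
(* So many periods that [C1 <= expR (T' * e)]; the successor keeps [T'] positive when [C1] is
   small. *)
pose n := (Num.truncn (ln C1 / (T * e))).+1; pose T' := n%:R * T.
have T'0 : 0 < T' by rewrite mulr_gt0.
have C1n : C1 <= expR (T' * e).
  rewrite -[C1]lnK ?posrE// ler_expR /T' -mulrA -ler_pdivrMr ?mulr_gt0//.
  have [q0|q0] := leP 0 (ln C1 / (T * e)); last by rewrite (le_trans (ltW q0)).
  by have /andP[_ /ltW] := truncn_itv q0.
have [P [Q [F [PQ sF cF]]]] := HC1 T' (ltW T'0).
have x0T' : trajectory A B T' x0 w0 = x0.
  rewrite /T'; elim: (n) => [|k IH]; first by rewrite mul0r trajectory0.
  rewrite -natr1 mulrDl mul1r; have [|-> _] := xT (k%:R * T) => //.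
  by rewrite mulr_ge0// ltW.
have Dx0 : interior D x0.
  by have [_] := xT 0 (lexx 0); rewrite trajectory0.
have [delta delta0 Hdelta] := compact_margin cC CU cf e0.
have [V [x0V VD] [S [sS HS VS]]] := local_return hAB T'0
  (controls_bounded_measurable 0 T' cU cw0) cw0.1 x0T' Dx0 delta0 PQ cF.
have HS' w : w \in S -> controls U w /\ forall t, f (w t) <= f (w0 t) + e.
  move=> wS; have [mw ww0] := HS w wS; split.
    by split => // t; have [] := Hdelta _ _ (w0C t) (ww0 t).
  move=> t; have [_] := Hdelta _ _ (w0C t) (ww0 t).
  by rewrite -lerBlDl; exact: le_trans (ler_norm _).
have w0T' t : w0 (t + T') = w0 t by rewrite /T' periodic_mul.
have iter := iterate_return cU T'0 (ltW e0) cw0 w0T' HS' VS.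
have [L [HL KL]] := control_set_steering hD cK KD (interior_subset Dx0) x0V.
pose tm := \sum_(p <- L) `|p.1|.
have tm0 : 0 <= tm by rewrite sumr_ge0.
(* Excess cost independent of [tau]: steering, replacing [tau - p.1] by [tau] in front of the mean,
   and the incomplete period. *)
pose C2 := (M + `|avg + e|) * tm + (M * T + M * T).
have C20 : 0 <= C2 by rewrite addr_ge0 ?mulr_ge0 ?addr_ge0 ?mulr_ge0// ltW.
(* [size L] is bounded by its exponential, and [T' * (h + e)] pays for the overshoot of the last
   return beyond [tau]. *)
pose C3 := (size L)%:R + T' * (h + e) + C2.
(* The first threshold leaves room for steering and makes [tau] positive; the second gives
   [C3 <= tau * e]. *)
apply: (@limf_esup_pinfty_le _ _ _ (Num.max (tm + 1) (C3 / e))) => tau.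
rewrite ge_max => /andP[tau1 tau2].
have tau0 : 0 < tau by rewrite (lt_le_trans _ tau1)// ltr_wpDl.
(* Enough returns to pass [tau], with [j - 1] of them still within it; the endpoint in [D] then lies
   beyond [tau]. *)
pose j := (Num.truncn (tau / T')).+1.
have /andP[j1 j2] := truncn_itv (divr_ge0 (ltW tau0) (ltW T'0)).
rewrite -/j ltr_pdivrMr// in j2; rewrite ler_pdivlMr// in j1.
have [Sj [sSj HSj VSj]] := iter j.
have act p v : p \in L -> v \in Sj ->
    action tau f (cat_control p.1 p.2 v) <= tau * (avg + e) + C2.
  move=> pL vS; have [p0 cp] := HL _ pL; have [cv fv] := HSj _ vS.
  have ptm : p.1 <= tm.
    by rewrite /tm (big_rem p)//= (le_trans (ler_norm _))// lerDl sumr_ge0.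
  have ptau : p.1 <= tau by rewrite (le_trans ptm)// (le_trans _ tau1)// lerDl.
  have pp : 0 <= p.1 <= tau by rewrite ltW.
  apply: le_trans (action_cat_le cU cf fM cp cw0 cv fv pp) _.
  have stau : 0 <= tau - p.1 by rewrite subr_ge0.
  have := @Rintegral_periodic_le R T M (fun t => f (w0 t)) T0
    (fun t => congr1 f (w0T t)) (fun a b => bounded_measurable_control a b cU cf cw0)
    (fun t => fM _ (cw0.2 t)) _ stau.
  rewrite -/(action T f w0) -/avg => h1.
  have h2 : M * p.1 <= M * tm by rewrite ler_wpM2l.
  have h3 : - (p.1 * (avg + e)) <= `|avg + e| * tm.
    rewrite -mulrN mulrC (le_trans (ler_wpM2r (ltW p0) (ler_norm _)))// normrN.
    by rewrite ler_wpM2l.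
  rewrite /C2; lra.
pose St := [seq cat_control p.1 p.2 v | p <- L, v <- Sj].
have spanSt : spanning A B U tau K D [set` St].
  split=> [_ /allpairsP[[p v] /= [pL vS ->]]|x Kx].
    by apply: controls_cat; [have [] := HL _ pL|have [] := HSj _ vS].
  have [p pL Vp] := KL _ Kx; have [v vS Vv] := VSj _ Vp.
  have [p0 cp] := HL _ pL; have [cv fv] := HSj _ vS.
  exists (cat_control p.1 p.2 v); first by apply/allpairsP; exists (p, v).
  move=> t /andP[t0 ttau].
  have jT0 : 0 <= j%:R * T' by rewrite mulr_ge0// ltW.
  apply: (control_set_no_return cU hD (t := p.1 + j%:R * T')).
  - exact: controls_cat.
  - by rewrite t0/= (le_trans ttau)// (le_trans (ltW j2))// lerDr ltW.
  - exact: KD.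
  - rewrite (trajectory_cat_right A B cU)//; last exact: ltW.
    exact: VD.
have aX : (a_inf A B U tau f K D <= (expR (tau * (h + avg + (e + e)) + C3))%:E)%E.
  apply: (@le_trans _ _ (\esum_(w in [set` St]) (expR (action tau f w))%:E)%E).
    by apply: ereal_inf_lbound; exists [set` St].
  apply: (le_trans (esum_seq_le (M := expR (tau * (avg + e) + C2)) _ (expR_ge0 _))).
    by move=> _ /allpairsP[[p v] /= [pL vS ->]]; rewrite expR_ge0 ler_expR act.
  rewrite lee_fin size_allpairs sSj sS natrM natrX.
  have -> : tau * (h + avg + (e + e)) + C3 =
     ((size L)%:R + (tau + T') * (h + e)) + (tau * (avg + e) + C2).
    by rewrite /C3; ring.
  rewrite [leRHS]expRD ler_wpM2r ?expR_ge0// [leRHS]expRD; apply: ler_pM => //.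
  - by apply: le_trans (expR_ge1Dx _); rewrite lerDr.
  - apply: (@le_trans _ _ (expR (T' * (h + e)) ^+ j)).
      rewrite lerXn2r ?nnegrE ?expR_ge0//.
      by rewrite (le_trans sF)// [_ * (h + e)]mulrDr addrC expRD ler_wpM2r// expR_ge0.
    rewrite -expRM_natl ler_expR mulrA ler_wpM2r ?addr_ge0 ?(ltW e0)//.
    by rewrite /j -natr1 mulrDl mul1r lerD2r.
have lX := lne_le (a_inf_ge0 _ _ _ _ _ _ _) aX.
apply: le_trans (lee_wpmul2l _ lX) _; first by rewrite lee_fin invr_ge0 ltW.
rewrite -EFinM lee_fin ler_pdivrMl//.
have : C3 <= tau * e by rewrite -ler_pdivrMr.
have -> : e3 = e + e + e by rewrite /e; field.
by move=> hC3; lra.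
Qed.

Theorem theorem6p2 (R : realType) (d m : nat)
    (A : 'M[R]_d) (B : 'M[R]_(d, m)) (U : set 'cV[R]_m)
    (D : set 'cV[R]_d) (f : 'cV[R]_m -> R)
    (hAB : controllable A B)
    (hA : hyperbolic A)
    (hUcompact : compact U)
    (hUnbhs : nbhs (0 : 'cV[R]_m) U)
    (hD : control_set A B U D)
    (hDint : interior D !=set0)
    (hf : {within U, continuous f})
    (K : set 'cV[R]_d)
    (hKcompact : compact K)
    (hK0 : K !=set0)
    (hKD : K `<=` D) :
  admissible A B U K D /\
  (P_inv A B U f K D <=
     (\sum_(l \in spectrum A)
        Num.max 0 ((alg_mult A l)%:R * complex.Re l))%:E +
     ereal_inf (periodic_averages A B U D f))%E.
Proof.
have [inv _ _] := hD; split.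
  split => //; first by have [x Kx] := hK0; exists x; exact: hKD.
  by move=> x Kx; exact/inv/hKD.
have [s [sA cov]] := flow_covering_exists A.
(* Moving the finite spectral sum to the left leaves a lower bound for an infimum, to be checked on
   each periodic average; an empty family is included. *)
rewrite (spectrum_sum sA) -leeBlDl//.
apply: le_ereal_inf_tmp => a av; rewrite leeBlDl//.
apply: P_inv_le_periodic hAB hUcompact hD hf hKcompact hKD cov _ av.
by apply: sumr_ge0 => l _; rewrite le_max lexx.
Qed.
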